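(* Suppose that (S* ) for each $x\in\mathbb{X}$ the function $a\mapsto c(x,a)$ is inf-compact on $\mathbb{A}$, and for each $x\in\mathbb{X}$ the transition probability $q(\cdot|x,a)$ is setwise continuous in $a\in\mathbb{A}$; and that for a sequence $\{\alpha_n\}_{n\ge1}\subset[0,1)$ with $\alpha_n\uparrow1$, ($\underline{B}_{\{\alpha_n\}}$) $w^*:=\inf_{x\in\mathbb{X}}w(x)<+\infty$ and $\liminf_{n\to\infty}u_{\alpha_n}(x)<+\infty$ for all $x\in\mathbb{X}$. Let $$u(x):=\liminf_{n\to\infty}u_{\alpha_n}(x),\qquad x\in\mathbb{X}.$$ Then there exists a deterministic policy $\phi$ such that $$c(x,\phi(x))+\int_{\mathbb{X}}u(y)\,q(dy|x,\phi(x))\le\overline{w}+u(x),\qquad x\in\mathbb{X}.$$ Therefore, $\phi$ is a deterministic average-cost optimal policy.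
   Context: Setting (MDP). The state space $\mathbb{X}$ and the action space $\mathbb{A}$ are Borel subsets of Polish spaces; every action in $\mathbb{A}$ is available at every state. The one-step cost $c:\mathbb{X}\times\mathbb{A}\to\mathbb{R}\cup\{+\infty\}$ is measurable and bounded below. The transition kernel $q(B|x,a)$ ($B\in\mathcal{B}(\mathbb{X})$) is a regular (measurable) transition probability from $\mathbb{X}\times\mathbb{A}$ to $\mathbb{X}$. A policy $\pi=(\pi_0,\pi_1,\dots)$ is a sequence of decision rules, $\pi_t$ being a regular transition probability from the histories $(\mathbb{X}\times\mathbb{A})^t\times\mathbb{X}$ to $\mathbb{A}$; $\Pi$ is the set of all policies. A deterministic policy is identified with a measurable map $\phi:\mathbb{X}\to\mathbb{A}$, which prescribes action $\phi(x)$ whenever the current state is $x$. For an initial state $x$ and policy $\pi$, $\mathbb{E}_x^\pi$ is the expectation with respect to the induced probability measure on trajectories $(x_0,a_0,x_1,a_1,\dots)$ (Ionescu Tulcea theorem). Criteria. $v_{N,\alpha}^\pi(x)=\mathbb{E}_x^\pi\sum_{t=0}^{N-1}\alpha^t c(x_t,a_t)$ for $N\in\{1,2,\dots\}$, $\alpha\in[0,1]$; $v_\alpha^\pi(x)=\mathbb{E}_x^\pi\sum_{t=0}^{\infty}\alpha^t c(x_t,a_t)$ for $\alpha\in[0,1)$; $v_\alpha(x)=\inf_{\pi\in\Pi}v_\alpha^\pi(x)$; $w^\pi(x)=\limsup_{N\to\infty}\frac1N v_{N,1}^\pi(x)$; $w(x)=\inf_{\pi\in\Pi}w^\pi(x)$.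 A policy $\pi$ is average-cost optimal if $w^\pi(x)=w(x)$ for all $x\in\mathbb{X}$. Notation. $m_\alpha=\inf_{x\in\mathbb{X}}v_\alpha(x)$ (finite for all $\alpha\in[0,1)$ when $w^*<+\infty$), $u_\alpha(x)=v_\alpha(x)-m_\alpha$, $\overline{w}=\limsup_{\alpha\uparrow1}(1-\alpha)m_\alpha$. Definitions. A function $f:\mathbb{U}\to\mathbb{R}\cup\{+\infty\}$ on a metric space $\mathbb{U}$ is inf-compact if for every $\lambda\in\mathbb{R}$ the level set $\{s\in\mathbb{U}:f(s)\le\lambda\}$ is compact. Setwise continuity of $q(\cdot|x,a)$ in $a$ means that $a\mapsto q(B|x,a)$ is continuous on $\mathbb{A}$ for every $B\in\mathcal{B}(\mathbb{X})$. *)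

(* Defs.v *)
From HB Require Import structures.
From mathcomp Require Import all_boot all_order all_algebra.
From mathcomp Require Import all_classical all_reals all_analysis.
From mathcomp Require Import measurable_realfun.

Set Implicit Arguments.
Unset Strict Implicit.
Unset Printing Implicit Defensive.

Import Order.TTheory GRing.Theory Num.Theory.
Import numFieldNormedType.Exports.

Local Open Scope classical_set_scope.
Local Open Scope ring_scope.
Local Open Scope ereal_scope.

(* Completeness is part of the type of S; a Hausdorff pseudometric is a metric. *)
Definition polish (R : realType) (S : completePseudoMetricType R) : Prop :=
  hausdorff_space S /\ exists2 E : set S, countable E & dense E.

Definition borel_set (S : topologicalType) (D : set S) : Prop :=
  <<s (@open S) >> D.

(* The subset D of S as a space of its own, with the topology induced by S and
   the Borel sigma-algebra of that topology. The point x0 is there only because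
   measurable types are pointed; it plays no other role. *)
Definition borel_sub (S : topologicalType) (D : set S) (x0 : D) : Type :=
  set_type D.

Section borel_sub_instances.
Context (S : topologicalType) (D : set S) (x0 : D).

HB.instance Definition _ := Topological.copy (borel_sub x0) (set_type D).
HB.instance Definition _ := isPointed.Build (borel_sub x0) x0.
HB.instance Definition _ :=
  @isMeasurable.Build (sigma_display (@open (borel_sub x0))) (borel_sub x0)
    <<s (@open (borel_sub x0)) >>
    (@sigma_algebra0 _ setT _) (@sigma_algebraC _ _)
    (@sigma_algebra_bigcup _ setT _).

End borel_sub_instances.

Definition inf_compact (R : realType) (U : topologicalType) (f : U -> \bar R) :
    Prop :=
  forall l : R, compact [set s | f s <= l%:E].

(* Trajectories (x_0, a_0, x_1, a_1, ...) with the product sigma-algebra. *)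
Section trajectories.
Context (dX dA : measure_display) (X : measurableType dX)
  (A : measurableType dA).

Definition coordinate_cylinders : set (set (nat -> X * A)) :=
  [set C | exists t : nat, exists2 B : set (X * A), measurable B &
    C = (fun w => w t) @^-1` B].

Definition trajectory : measurableType coordinate_cylinders.-sigma :=
  g_sigma_algebraType coordinate_cylinders.

Definition state (w : trajectory) (t : nat) : X := (w t).1.
Definition action (w : trajectory) (t : nat) : A := (w t).2.

Definition history (t : nat) : measurableType _ :=
  (t.-tuple (X * A) * X)%type.

Definition history_of (t : nat) (w : trajectory) : history t :=
  ([tuple w i | i < t], state w t).

End trajectories.

Section mdp.
Context (R : realType) (dX dA : measure_display) (X : measurableType dX)
  (A : measurableType dA).

Definition policy : Type := forall t : nat, R.-pker (history X A t) ~> A.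

Definition deterministic_policy (phi : {mfun X >-> A}) : policy :=
  fun t => kdirac (measurableT_comp (measurable_funPT phi) measurable_snd).

Variables (q : R.-pker (X * A) ~> X) (c : X * A -> \bar R).

(* The law of x_0 is the Dirac measure at x, P(a_t in C | h_t) = pi_t(C | h_t) and
   P(x_{t+1} in B | h_t, a_t) = q(B | x_t, a_t), the conditional probabilities
   being expressed by their integrals over the events generated by the
   conditioning variables. *)
Definition is_strategic_measure (pi : policy) (x : X)
    (P : probability (trajectory X A) R) : Prop :=
  [/\ forall B : set X, measurable B ->
        P [set w | B (state w 0%N)] = \d_x B,
      forall (t : nat) (H : set (history X A t)) (C : set A),
        measurable H -> measurable C ->
        P [set w | H (history_of t w) /\ C (action w t)] =
        \int[P]_(w in [set w | H (history_of t w)]) pi t (history_of t w) C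
    & forall (t : nat) (G : set (history X A t * A)) (B : set X),
        measurable G -> measurable B ->
        P [set w | G (history_of t w, action w t) /\ B (state w t.+1)] =
        \int[P]_(w in [set w | G (history_of t w, action w t)])
          q (state w t, action w t) B].

(* By the Ionescu Tulcea theorem there is exactly one such P. *)
Definition strategic_measure (pi : policy) (x : X) :
    probability (trajectory X A) R :=
  get [set P | is_strategic_measure pi x P].

Definition v_fin (N : nat) (alpha : R) (pi : policy) (x : X) : \bar R :=
  \int[strategic_measure pi x]_w
    \sum_(0 <= t < N) (alpha ^+ t)%:E * c (state w t, action w t).

Definition v_disc (alpha : R) (pi : policy) (x : X) : \bar R :=
  \int[strategic_measure pi x]_w
    \sum_(0 <= t <oo) (alpha ^+ t)%:E * c (state w t, action w t).

Definition v_opt (alpha : R) (x : X) : \bar R :=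
  ereal_inf [set v_disc alpha pi x | pi in [set: policy]].

Definition w_avg (pi : policy) (x : X) : \bar R :=
  limn_esup (fun N => (N%:R^-1)%:E * v_fin N 1 pi x).

Definition w_opt (x : X) : \bar R :=
  ereal_inf [set w_avg pi x | pi in [set: policy]].

Definition average_cost_optimal (pi : policy) : Prop :=
  forall x : X, w_avg pi x = w_opt x.

Definition w_star : \bar R := ereal_inf [set w_opt x | x in [set: X]].

Definition m_disc (alpha : R) : \bar R :=
  ereal_inf [set v_opt alpha x | x in [set: X]].

Definition u_disc (alpha : R) (x : X) : \bar R := v_opt alpha x - m_disc alpha.

Definition w_bar : \bar R :=
  limf_esup (fun alpha : R => (1 - alpha)%:E * m_disc alpha) (1%R : R)^'-.

Definition u_lim (alpha : nat -> R) (x : X) : \bar R :=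
  limn_einf (fun n => u_disc (alpha n) x).

End mdp.

(* Main.v *)
Require Import Defs.
From HB Require Import structures.
From mathcomp Require Import all_boot all_order all_algebra.
From mathcomp Require Import all_classical all_reals all_analysis.
From mathcomp Require Import measurable_realfun ring lra.

(** After subtraction of a lower bound [K] the costs are nonnegative, and every
    criterion changes by an explicit constant. For a discount factor [b], value
    iteration from 0 increases to a function [value]. Setwise continuity of the
    kernel makes the integral of a nonnegative function lower semicontinuous in
    the action ([closed_sublevels_integral]), so the cost of an action plus the
    integral of a continuation value is inf-compact in the action. Compactness
    then lets minimisation commute with increasing limits ([cost_to_go_limit]).
    Hence [value] dominates its own minimal cost to go, a deterministic policy
    attains it, and no policy does better: [value] is the optimal discounted
    cost up to a constant ([v_optE]). In terms of the relative value [u_disc],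
    for every state [x] there is an action [a] with

      c (x, a) + b * \int u_disc dq(x, a) <= u_disc x + (1 - b) * m_disc.

    Let [b] run through the sequence [alpha n]. The infima [U n] of the later
    relative values increase to [u_lim], and by definition of [w_bar] the last
    term is almost below [w_bar] for large [n]. Replacing on the left later
    relative values by [U n] and later discount factors by [alpha n], one gets
    for each [n] a nonempty compact set of actions, and these sets are nested. An action common
    to all of them satisfies the optimality inequality at [x], by monotone
    convergence ([u_lim_inequality]). A measurable choice of minimisers of
    c (x, a) + \int u_lim dq(x, a) is the policy [phi]. Iterating the inequality
    along its trajectories bounds the cost of [N] stages by [u_lim x + N w_bar],
    so the average cost of [phi] is at most [w_bar]. Conversely [w_bar] is at
    most the average cost of any policy, by summation by parts
    ([w_bar_le_w_avg]).

    Two general facts carry this argument. The first is the measurable selection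
    of minimisers ([measurable_minimiser]), without any continuity in the state.
    It rests on the theorem that a Borel set with compact sections has a Borel
    projection ([borel_compact_proj]), which is deduced from a simultaneous
    separation theorem for analytic sets ([borel_cover_analytic]). The second is
    the Ionescu Tulcea theorem ([ionescu_tulcea_extension]): the law of the
    trajectories is specified by conditional probabilities, and their use in
    any computation presupposes that such a law exists
    ([strategic_measure_exists]). *)

Set Implicit Arguments.
Unset Strict Implicit.
Unset Printing Implicit Defensive.

Import Order.TTheory GRing.Theory Num.Theory.
Import numFieldNormedType.Exports.

Local Open Scope classical_set_scope.
Local Open Scope ring_scope.
Local Open Scope ereal_scope.

(** * Analytic sets *)

(** Agreement on initial segments generates the topology of the Baire space
    [nat -> nat], whose closed sets and continuous functions are described
    below in these terms. *)
Definition agree (Z : Type) (k : nat) (s s' : nat -> Z) : Prop :=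
  forall i, (i < k)%N -> s i = s' i.

Definition seq_closed (F : set (nat -> nat)) : Prop :=
  forall s, (forall k, exists2 s', F s' & agree k s s') -> F s.

Definition seq_continuous (T : topologicalType) (F : set (nat -> nat))
    (f : (nat -> nat) -> T) : Prop :=
  forall s, F s -> forall U, nbhs (f s) U ->
    exists k, forall s', F s' -> agree k s s' -> U (f s').

(** The continuous images of the closed subsets of the Baire space. An element
    of [F] is called a code of its image under [f]. *)
Definition analytic (T : topologicalType) (A : set T) : Prop :=
  exists F (f : (nat -> nat) -> T),
    [/\ seq_closed F, seq_continuous F f & f @` F = A].

Lemma agree_sym (Z : Type) k (s s' : nat -> Z) : agree k s s' -> agree k s' s.
Proof. by move=> h i ik; rewrite h. Qed.

Lemma agree_trans (Z : Type) k (s t u : nat -> Z) : agree k s t -> agree k t u -> agree k s u.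
Proof. by move=> h h' i ik; rewrite h// h'. Qed.

Lemma agree_leq (Z : Type) j k (s s' : nat -> Z) : (j <= k)%N -> agree k s s' -> agree j s s'.
Proof. by move=> jk h i ij; apply: h; exact: leq_trans jk. Qed.

(** A code carries countably many codes, the [n]-th of which sits at the
    positions [pickle (n, j)]; [join] puts them together, with the value [0]
    at the positions that code no pair. *)
Definition slice (n : nat) (s : nat -> nat) : nat -> nat :=
  fun j => s (pickle (n, j)).

Definition join (ss : nat -> nat -> nat) : nat -> nat :=
  fun m => if unpickle m is Some (n, j) then ss n j else 0%N.

Lemma slice_join n ss : slice n (join ss) = ss n.
Proof. by apply/funext => j; rewrite /slice /join pickleK. Qed.

Lemma agree_slice n k :
  exists k', forall s s', agree k' s s' -> agree k (slice n s) (slice n s').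
Proof.
exists (\max_(j < k) (pickle (n, val j)).+1) => s s' h j jk; apply: h.
exact: (leq_bigmax (Ordinal jk)).
Qed.

Lemma seq_closed_slice n F : seq_closed F -> seq_closed (slice n @^-1` F).
Proof.
move=> cF s hs; apply: cF => k; have [k' hk'] := agree_slice n k.
by have [s' Fs' ss'] := hs k'; exists (slice n s') => //; exact: hk'.
Qed.

Lemma seq_continuous_slice (T : topologicalType) n F (f : (nat -> nat) -> T) :
  seq_continuous F f -> seq_continuous (slice n @^-1` F) (f \o slice n).
Proof.
move=> cf s Fs U /(cf _ Fs)[k hk]; have [k' hk'] := agree_slice n k.
by exists k' => s' Fs' ss'; apply: hk => //; exact: hk'.
Qed.

Lemma seq_continuous_sub (T : topologicalType) (F F' : set (nat -> nat))
  (f : (nat -> nat) -> T) :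
  F' `<=` F -> seq_continuous F f -> seq_continuous F' f.
Proof.
move=> F'F cf s Fs U /(cf _ (F'F _ Fs))[k hk].
by exists k => s' /F'F Fs' ss'; exact: hk.
Qed.

Lemma seq_closedI F F' : seq_closed F -> seq_closed F' -> seq_closed (F `&` F').
Proof.
by move=> cF cF' s hs; split; [apply: cF|apply: cF'] => k;
  have [s' []] := hs k; exists s'.
Qed.

Lemma seq_closed_bigcap (J : Type) (F : J -> set (nat -> nat)) :
  (forall i, seq_closed (F i)) -> seq_closed (\bigcap_i F i).
Proof.
move=> cF s hs i _; apply: cF => k.
by have [s' Fs' ?] := hs k; exists s' => //; exact: Fs'.
Qed.

Lemma seq_closed_eq (T : topologicalType) F (f g : (nat -> nat) -> T) :
  hausdorff_space T -> seq_closed F -> seq_continuous F f ->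
  seq_continuous F g -> seq_closed (F `&` [set s | f s = g s]).
Proof.
move=> hT cF cf cg s hs.
have Fs : F s by apply: cF => k; have [s' [? _]] := hs k; exists s'.
split => //=; apply: hT => U V /(cf _ Fs)[k hk] /(cg _ Fs)[l hl].
have [s' [Fs' fg] ss'] := hs (maxn k l).
exists (f s'); split; first by apply: hk => //; apply: agree_leq ss'; rewrite leq_maxl.
by rewrite fg; apply: hl => //; apply: agree_leq ss'; rewrite leq_maxr.
Qed.

Lemma seq_closed_preimage (T : topologicalType) F (f : (nat -> nat) -> T) C :
  closed C -> seq_closed F -> seq_continuous F f ->
  seq_closed (F `&` (f @^-1` C)).
Proof.
move=> cC cF cf s hs.
have Fs : F s by apply: cF => k; have [s' [? _]] := hs k; exists s'.
split => //=; apply: cC => U /(cf _ Fs)[k hk].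
by have [s' [Fs' Cs'] ss'] := hs k; exists (f s'); split => //; exact: hk.
Qed.

Lemma analytic_image (T X : topologicalType) (p : T -> X) (A : set T) :
  continuous p -> analytic A -> analytic (p @` A).
Proof.
move=> cp [F [f [cF cf <-]]]; exists F, (p \o f); split => //.
- by move=> s Fs U pU; apply: (cf s Fs (p @^-1` U)); exact: cp.
- by rewrite -[LHS]image_comp.
Qed.

(** The first entry of slice 0 chooses the index of a set, and slice 1 is a
    code for a point of that set. *)
Lemma analytic_bigcup (T : topologicalType) (A : nat -> set T) :
  (forall n, analytic (A n)) -> analytic (\bigcup_n A n).
Proof.
move=> hA.
have /choice[Ff hF] : forall n, exists Ff : set (nat -> nat) * ((nat -> nat) -> T),
    [/\ seq_closed Ff.1, seq_continuous Ff.1 Ff.2 & Ff.2 @` Ff.1 = A n].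
  by move=> n; have [F [f h]] := hA n; exists (F, f).
pose F := [set s | (Ff (slice 0 s 0)).1 (slice 1 s)].
pose f s := (Ff (slice 0 s 0)).2 (slice 1 s).
exists F, f; split.
- move=> s hs; have [cF _ _] := hF (slice 0 s 0).
  apply: cF => k; have [k0 hk0] := agree_slice 0 1.
  have [k1 hk1] := agree_slice 1 k.
  have [s' Fs' ss'] := hs (maxn k0 k1); exists (slice 1 s').
    have <- // : slice 0 s' 0 = slice 0 s 0.
    by apply/esym/hk0 => //; apply: agree_leq ss'; rewrite leq_maxl.
  by apply: hk1 => //; apply: agree_leq ss'; rewrite leq_maxr.
- move=> s Fs U; have [_ cf _] := hF (slice 0 s 0).
  move=> /(cf _ Fs)[k hk]; have [k0 hk0] := agree_slice 0 1.
  have [k1 hk1] := agree_slice 1 k.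
  exists (maxn k0 k1) => s' Fs' ss'.
  have e : slice 0 s' 0 = slice 0 s 0.
    by apply/esym/hk0 => //; apply: agree_leq ss'; rewrite leq_maxl.
  rewrite /f e; apply: hk; first by rewrite -e.
  by apply: hk1 => //; apply: agree_leq ss'; rewrite leq_maxr.
- apply/seteqP; split => [_ [s Fs <-]|x [n _]].
    exists (slice 0 s 0) => //; have [_ _ <-] := hF (slice 0 s 0).
    by exists (slice 1 s).
  have [_ _ <-] := hF n; move=> [s Fs <-].
  pose ss (k : nat) := if k is 0%N then fun=> n else s.
  by exists (join ss); rewrite /F /f /= !slice_join.
Qed.

(** The slices are codes for points of the respective sets. In a Hausdorff
    space it is a closed condition on them that they code the same point. *)
Lemma analytic_bigcap (T : topologicalType) (A : nat -> set T) :
  hausdorff_space T -> (forall n, analytic (A n)) -> analytic (\bigcap_n A n).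
Proof.
move=> hT hA.
have /choice[Ff hF] : forall n, exists Ff : set (nat -> nat) * ((nat -> nat) -> T),
    [/\ seq_closed Ff.1, seq_continuous Ff.1 Ff.2 & Ff.2 @` Ff.1 = A n].
  by move=> n; have [F [f h]] := hA n; exists (F, f).
pose F n := slice n @^-1` (Ff n).1.
pose f n := (Ff n).2 \o slice n.
have cF n : seq_closed (F n) by apply: seq_closed_slice; have [] := hF n.
have cf n : seq_continuous (F n) (f n).
  by apply: seq_continuous_slice; have [] := hF n.
exists (\bigcap_n (F 0%N `&` F n `&` [set s | f n s = f 0%N s])), (f 0%N); split.
- apply: seq_closed_bigcap => n; apply: seq_closed_eq => //.
  + exact: seq_closedI.
  + by apply: seq_continuous_sub (cf n); exact: subIsetr.
  + by apply: seq_continuous_sub (cf 0%N); exact: subIsetl.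
- by apply: seq_continuous_sub (cf 0%N) => s /(_ 0%N Logic.I)[[]].
- apply/seteqP; split => [_ [s Fs <-] n _|x Ax].
    have [[_ Fn] <-] := Fs n Logic.I.
    by have [_ _ <-] := hF n; exists (slice n s).
  have /choice[ss hss] : forall n, exists s, (Ff n).1 s /\ (Ff n).2 s = x.
    move=> n; have := Ax n Logic.I; have [_ _ <-] := hF n.
    by move=> [s ? ?]; exists s.
  exists (join ss); last by rewrite /f /= slice_join; have [] := hss 0%N.
  move=> n _; rewrite /F /f /= !slice_join; have [? ->] := hss n.
  by have [? ->] := hss 0%N.
Qed.

Lemma analytic_setX (T X : topologicalType) (A : set T) (B : set X) :
  analytic A -> analytic B -> analytic (A `*` B).
Proof.
move=> [F [f [cF cf <-]]] [G [g [cG cg <-]]].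
exists (slice 0 @^-1` F `&` slice 1 @^-1` G),
  (fun s => (f (slice 0 s), g (slice 1 s))); split.
- by apply: seq_closedI; exact: seq_closed_slice.
- move=> s [Fs Gs] U [[U1 U2] [/= nU1 nU2] UU].
  have [k hk] := seq_continuous_slice cf Fs nU1.
  have [l hl] := seq_continuous_slice cg Gs nU2.
  exists (maxn k l) => s' [Fs' Gs'] ss'; apply: UU; split => /=.
    by apply: hk => //; apply: agree_leq ss'; rewrite leq_maxl.
  by apply: hl => //; apply: agree_leq ss'; rewrite leq_maxr.
- apply/seteqP; split => [_ [s [Fs Gs] <-]|[x y]].
    by split; [exists (slice 0 s)|exists (slice 1 s)].
  move=> [/= [s Fs <-] [s' Gs' <-]].
  pose ss (k : nat) := if k is 0%N then s else s'.
  by exists (join ss); rewrite /= !slice_join.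
Qed.

Lemma analytic_closed (T : topologicalType) (A C : set T) :
  closed C -> analytic A -> analytic (A `&` C).
Proof.
move=> cC [F [f [cF cf <-]]]; exists (F `&` f @^-1` C), f; split.
- exact: seq_closed_preimage.
- by apply: seq_continuous_sub cf; exact: subIsetl.
- apply/seteqP; split=> [_ [s [Fs Cs] <-]|_ [[s Fs <-] Cs]]; last by exists s.
  by split => //; exists s.
Qed.

(** Being mapped into [U] is not a closed condition on codes. It becomes one
    if the code also announces a number [k], the first entry of slice 0, such
    that all codes agreeing with it up to [k] are mapped into [U]. *)
Lemma analytic_open (T : topologicalType) (A U : set T) :
  open U -> analytic A -> analytic (A `&` U).
Proof.
move=> oU [F [f [cF cf <-]]].
pose G := [set s | forall s', F s' ->
  agree (slice 0 s 0) (slice 1 s) s' -> U (f s')].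
exists (slice 1 @^-1` F `&` G), (f \o slice 1); split.
- move=> s hs; split.
    apply: (seq_closed_slice (n := 1) cF) => k.
    by have [s' [? _] ?] := hs k; exists s'.
  move=> s' Fs' ss'; have [k0 hk0] := agree_slice 0 1.
  have [k1 hk1] := agree_slice 1 (slice 0 s 0).
  have [t [_ Gt] st] := hs (maxn k0 k1); apply: Gt => //.
  have <- : slice 0 s 0 = slice 0 t 0.
    by apply: hk0 => //; apply: agree_leq st; rewrite leq_maxl.
  apply: agree_trans ss'; apply: agree_sym; apply: hk1.
  by apply: agree_leq st; rewrite leq_maxr.
- by apply: seq_continuous_sub (seq_continuous_slice cf); exact: subIsetl.
- apply/seteqP; split=> [_ [s [Fs Gs] <-]|_ [[s Fs <-] Us]].
    by split; [exists (slice 1 s)|exact: Gs].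
  have [k hk] := cf _ Fs _ (open_nbhs_nbhs (conj oU Us)).
  pose ss (i : nat) := if i is 0%N then fun=> k else s.
  exists (join ss); rewrite /= ?slice_join//.
  by split => // s' Fs'; rewrite !slice_join; exact: hk.
Qed.

Lemma sigma_algebra_bianalytic (T : topologicalType) :
  hausdorff_space T -> analytic [set: T] ->
  sigma_algebra setT [set A : set T | analytic A /\ analytic (~` A)].
Proof.
move=> hT aT; split.
- split; last by rewrite setC0.
  by have := analytic_closed closed0 aT; rewrite setI0.
- by move=> A [aA aA']; rewrite setTD; split; rewrite ?setCK.
- move=> A hA; split; first by apply: analytic_bigcup => n; have [] := hA n.
  by rewrite setC_bigcup; apply: analytic_bigcap => // n; have [] := hA n.
Qed.

(** Open and closed sets are analytic, so they belong to the sigma-algebra of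
    the sets that are analytic together with their complement. *)
Lemma borel_analytic (T : topologicalType) (A : set T) :
  hausdorff_space T -> analytic [set: T] -> borel_set A -> analytic A.
Proof.
move=> hT aT bA; suff : [set A : set T | analytic A /\ analytic (~` A)] A by case.
move: A bA; apply: smallest_sub; first exact: sigma_algebra_bianalytic.
move=> U oU; split.
  by rewrite -[U]setTI; exact: analytic_open.
by rewrite -[~` U]setTI; apply: analytic_closed => //; exact: open_closedC.
Qed.

(** * A simultaneous separation theorem *)

Lemma borel_setC (T : topologicalType) (A : set T) :
  borel_set A -> borel_set (~` A).
Proof. by rewrite -setTD; exact: sigma_algebraCD. Qed.

Lemma borel_set_bigcup (T : topologicalType) (A : nat -> set T) :
  (forall n, borel_set (A n)) -> borel_set (\bigcup_n A n).
Proof. exact: sigma_algebra_bigcup. Qed.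

Lemma borel_set_bigcap (T : topologicalType) (A : nat -> set T) :
  (forall n, borel_set (A n)) -> borel_set (\bigcap_n A n).
Proof.
move=> bA; rewrite -[\bigcap_n _]setCK setC_bigcap; apply: borel_setC.
by apply: borel_set_bigcup => n; exact: borel_setC.
Qed.

Lemma borel_set_open (T : topologicalType) (A : set T) : open A -> borel_set A.
Proof. exact: sub_sigma_algebra. Qed.

Lemma borel_set_closed (T : topologicalType) (A : set T) :
  closed A -> borel_set A.
Proof.
move=> cA; rewrite -[A]setCK; apply: borel_setC; apply: borel_set_open.
exact: closed_openC.
Qed.

Section borel_cover.
Context (T X : topologicalType) (I : countType) (p : T -> X) (V : I -> set T).

(** If every [V i] is [setT] and [p] is the identity, the complements of the
    [B i] are Borel sets that contain the [D i] and have no common point in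
    [E]: this is the simultaneous separation of the [D i] on [E]. The sets [V
    i] and the map [p] allow for the covering of a subset of a product by
    open-by-Borel rectangles. *)
Definition borel_covered (E : set T) (D : I -> set X) : Prop :=
  exists B : I -> set X, [/\ forall i, borel_set (B i),
    forall i, B i `&` D i = set0 &
    forall t, E t -> exists i, V i t /\ B i (p t)].

(** A countable decomposition of [E] is dealt with by uniting, index by index,
    the Borel sets found for the pieces. *)
Lemma borel_covered_bigcup E D (E_ : nat -> set T) (D_ : nat -> I -> set X) :
  E `<=` \bigcup_v E_ v -> (forall v i, D i `<=` D_ v i) ->
  (forall v, borel_covered (E_ v) (D_ v)) -> borel_covered E D.
Proof.
move=> EE DD /choice[B hB]; exists (fun i => \bigcup_v B v i); split.
- by move=> i; apply: borel_set_bigcup => v; have [bB _ _] := hB v; exact: bB.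
- move=> i; apply/seteqP; split=> // x [[v _ Bx] Dx].
  by have [_ /(_ i) <- _] := hB v; split => //; exact: DD.
- move=> t /EE[v _ Et]; have [_ _ /(_ t Et)[i [Vi Bi]]] := hB v.
  by exists i; split => //; exists v.
Qed.

(** If it is [D i0] that decomposes, the Borel sets of index [i0] have to be
    intersected and the others united: a point that one of the families does
    not cover at [i0] is covered by this family at another index. *)
Lemma borel_covered_bigcup_avoid E D (D_ : nat -> I -> set X) i0 :
  (forall v i, i != i0 -> D i `<=` D_ v i) -> D i0 `<=` \bigcup_v D_ v i0 ->
  (forall v, borel_covered E (D_ v)) -> borel_covered E D.
Proof.
move=> DD DD0 /choice[B hB].
exists (fun i => if i == i0 then \bigcap_v B v i else \bigcup_v B v i); split.
- by move=> i; case: ifP => _; [apply: borel_set_bigcap|apply: borel_set_bigcup];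
    move=> v; have [bB _ _] := hB v; exact: bB.
- move=> i; apply/seteqP; split=> // x; case: ifPn => [/eqP ->|ii0].
    move=> [Bx /DD0[v _ Dx]]; have [_ /(_ i0) <- _] := hB v.
    by split => //; exact: Bx.
  by move=> [[v _ Bx] /(DD v _ ii0) Dx]; have [_ /(_ i) <- _] := hB v.
- move=> t Et; have [[v hv]|hall] := pselect (exists v, ~ (V i0 t /\ B v i0 (p t))).
    have [_ _ /(_ t Et)[i [Vi Bi]]] := hB v.
    exists i; split => //; case: ifPn => [/eqP ii0|_]; last by exists v.
    by exfalso; apply: hv; rewrite -ii0.
  have h v : V i0 t /\ B v i0 (p t) by apply: contrapT => ?; apply: hall; exists v.
  exists i0; rewrite eqxx; split; first by have [] := h 0%N.
  by move=> v _; have [] := h v.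
Qed.

End borel_cover.

Section constrained.
Context (I : countType).

(** The position of the [j]-th entry of the [o]-th of countably many sequences
    stored in a single one. *)
Let code (o : option I) (j : nat) : nat := pickle (o, j).

(** One list [l] prescribes initial entries of countably many sequences at
    once: in the proof below, the index [None] stands for a code of a point of
    [E] and [Some i] for a code of a point of [D i]. *)
Definition constrained (l : seq nat) (o : option I) : set (nat -> nat) :=
  [set s | forall j, (code o j < size l)%N -> s j = nth 0%N l (code o j)].

Lemma constrained_rcons l v o s : constrained l o s ->
  (forall j, code o j = size l -> s j = v) -> constrained (rcons l v) o s.
Proof.
move=> ls lv j; rewrite size_rcons ltnS leq_eqVlt nth_rcons => /orP[/eqP jl|jl].
  by rewrite jl ltnn eqxx; exact: lv.
by rewrite jl; exact: ls.
Qed.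

Lemma constrained_mkseq r o k : exists m, forall s,
  constrained (mkseq r m) o s -> agree k (fun j => r (code o j)) s.
Proof.
exists (\max_(j < k) (code o (val j)).+1) => s hs j jk.
have h : (code o j < \max_(j < k) (code o (val j)).+1)%N.
  exact: (leq_bigmax (Ordinal jk)).
by rewrite hs ?size_mkseq// nth_mkseq.
Qed.

Lemma constrained_leq r o m n : (m <= n)%N ->
  constrained (mkseq r n) o `<=` constrained (mkseq r m) o.
Proof.
move=> mn s hs j; rewrite size_mkseq => jm.
have jn := leq_trans jm mn.
by rewrite hs ?size_mkseq// !nth_mkseq.
Qed.

End constrained.

Lemma seq_branch (P : seq nat -> Prop) : P [::] ->
  (forall l, P l -> exists v, P (rcons l v)) ->
  exists r : nat -> nat, forall k, P (mkseq r k).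
Proof.
move=> P0 PS.
have /choice[next hnext] : forall l, exists v, P l -> P (rcons l v).
  move=> l; have [/PS[v Pv]|nPl] := pselect (P l); first by exists v.
  by exists 0%N.
pose L := fix L k := if k is k'.+1 then rcons (L k') (next (L k')) else [::].
have PL k : P (L k) by elim: k => //= k; exact: hnext.
exists (fun k => next (L k)) => k.
suff -> : mkseq (fun k => next (L k)) k = L k by [].
by elim: k => // k IH; rewrite mkseqS IH.
Qed.

(** This is Novikov's separation theorem for analytic sets, in a form with
    parameters. If the covering did not exist, then prescribing the entries of
    the codes one after the other, which decomposes [E] or one of the [D i]
    into countably many pieces, would produce an infinite branch along which
    no covering exists at any stage. The branch determines a point [t] of [E].
    Some [V i] contains [t] while [D i] misses [p t], so [p t] differs from
    the point of [D i] that the branch determines, and two disjoint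
    neighbourhoods provide a covering at a late stage, a contradiction. *)
Lemma borel_cover_analytic (T X : topologicalType) (I : countType) (p : T -> X)
    (V : I -> set T) (E : set T) (D : I -> set X) :
  hausdorff_space X -> continuous p -> (forall i, open (V i)) ->
  analytic E -> (forall i, analytic (D i)) ->
  (forall t, E t -> exists i, V i t /\ ~ D i (p t)) -> borel_covered p V E D.
Proof.
move=> hX cp oV [F [f [cF cf fE]]] aD ED.
have {aD}/choice[Gg hG] : forall i,
    exists Gg : set (nat -> nat) * ((nat -> nat) -> X),
    [/\ seq_closed Gg.1, seq_continuous Gg.1 Gg.2 & Gg.2 @` Gg.1 = D i].
  by move=> i; have [G [g h]] := aD i; exists (G, g).
pose E_ l := f @` (F `&` constrained l (None : option I)).
pose D_ l i := (Gg i).2 @` ((Gg i).1 `&` constrained l (Some i)).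
apply: contrapT => ncov.
have [|l|r hr] := @seq_branch (fun l => ~ borel_covered p V (E_ l) (D_ l)).
- have e0 (o : option I) : constrained [::] o = [set: nat -> nat].
    by apply/seteqP; split.
  have -> : E_ [::] = E by rewrite /E_ e0 setIT.
  have -> // : D_ [::] = D.
  by apply/funext => i; rewrite /D_ e0 setIT; have [_ _ ->] := hG i.
- move=> nl; apply: contrapT => /forallNP hv; apply: nl.
  have {}hv v : borel_covered p V (E_ (rcons l v)) (D_ (rcons l v)).
    exact: contrapT.
  have miss (o : option I) v : (forall j : nat, pickle (o, j) != size l) ->
      constrained l o `<=` constrained (rcons l v) o.
    by move=> ol s ls; apply: constrained_rcons => // j /eqP; rewrite (negbTE (ol j)).
  have hit (o : option I) (j : nat) s : pickle (o, j) = size l -> constrained l o s ->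
      constrained (rcons l (s j)) o s.
    move=> ojl ls; apply: constrained_rcons => // j'.
    by rewrite -ojl => /(pcan_inj pickleK)[->].
  have Emiss v : (forall j : nat, pickle (None : option I, j) != size l) ->
      E_ l `<=` E_ (rcons l v).
    by move=> /miss h _ [s [Fs ls] <-]; exists s => //; split => //; exact: h.
  have Dmiss v i : (forall j : nat, pickle (Some i, j) != size l) ->
      D_ l i `<=` D_ (rcons l v) i.
    by move=> /miss h _ [s [Fs ls] <-]; exists s => //; split => //; exact: h.
  case e : (pickle_inv (size l) : option (option I * nat)%type) => [[[i0|] j0]|].
  + have e0 : pickle (Some i0, j0) = size l.
      by have := @pickle_invK (option I * nat)%type (size l); rewrite e.
    have neq (o : option I) (j : nat) : o != Some i0 -> pickle (o, j) != size l.
      move=> oi0; apply/eqP; rewrite -e0 => /(pcan_inj pickleK)[oE _].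
      by rewrite oE eqxx in oi0.
    apply: (@borel_covered_bigcup_avoid _ _ _ _ _ _ _
      (fun v => D_ (rcons l v)) i0) => [v i ii0||v].
    * by apply: Dmiss => j; exact: neq.
    * move=> _ [s [Gs ls] <-]; exists (s j0) => //; exists s => //.
      by split => //; exact: hit.
    * have [B [bB BD BE]] := hv v; exists B; split => // t Et; apply: BE.
      by apply: Emiss Et => j; exact: neq.
  + have e0 : pickle (None : option I, j0) = size l.
      by have := @pickle_invK (option I * nat)%type (size l); rewrite e.
    apply: (@borel_covered_bigcup _ _ _ _ _ _ _
      (fun v => E_ (rcons l v)) (fun v => D_ (rcons l v))) => // [|v i].
    * move=> _ [s [Fs ls] <-]; exists (s j0) => //; exists s => //.
      by split => //; exact: hit.
    * apply: Dmiss => j; apply/eqP; rewrite -e0.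
      by move/(pcan_inj pickleK).
  + have neq (o : option I) (j : nat) : pickle (o, j) != size l.
      by apply/eqP => ol; move: e; rewrite -ol pickleK_inv.
    apply: (@borel_covered_bigcup _ _ _ _ _ _ _
      (fun v => E_ (rcons l v)) (fun v => D_ (rcons l v))) => // [|v i].
    * by move=> t Et; exists 0%N => //; apply: Emiss Et => j; exact: neq.
    * by apply: Dmiss => j; exact: neq.
- pose s (o : option I) (j : nat) := r (pickle (o, j)).
  have FN : F (s None).
    apply: cF => k; have [m hm] := @constrained_mkseq I r None k.
    have : E_ (mkseq r m) !=set0.
      apply: contrapT => /nonemptyPn E0; apply: (hr m); rewrite E0.
      by exists (fun=> set0); split => //;
        [move=> _; exact: sigma_algebra0|move=> i; rewrite set0I].
    by move=> [_ [s' [Fs' /hm ss'] _]]; exists s'.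
  have Et : E (f (s None)) by rewrite -fE; exists (s None).
  have [i [Vi nDi]] := ED _ Et.
  have [k hk] := cf _ FN _ (open_nbhs_nbhs (conj (oV i) Vi)).
  have [m0 hm0] := @constrained_mkseq I r None k.
  have EV m : (m0 <= m)%N -> E_ (mkseq r m) `<=` V i.
    move=> mm _ [s' [Fs' /(constrained_leq mm)/hm0 ss'] <-].
    exact: hk.
  (* From stage m0 on the whole of E_ lies in V i, so that a single Borel set
     at index i makes a covering. *)
  have fin m U : (m0 <= m)%N -> borel_set U -> U `&` D_ (mkseq r m) i = set0 ->
      p @` E_ (mkseq r m) `<=` U -> False.
    move=> mm bU UD pE; apply: (hr m).
    exists (fun i' => if i' == i then U else set0); split.
    + by move=> i'; case: ifP => // _; exact: sigma_algebra0.
    + by move=> i'; case: ifPn => [/eqP ->//|_]; rewrite set0I.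
    + move=> t Emt; exists i; rewrite eqxx; split; first exact: EV Emt.
      by apply: pE; exists t.
  have [cG cg gD] := hG i.
  have GN : (Gg i).1 (s (Some i)).
    apply: cG => k'; have [m hm] := @constrained_mkseq I r (Some i) k'.
    have : D_ (mkseq r (maxn m m0)) i !=set0.
      apply: contrapT => /nonemptyPn D0.
      apply: (@fin (maxn m m0) setT); rewrite ?leq_maxr// ?D0 ?setI0//.
      by rewrite -setC0; apply: borel_setC; exact: sigma_algebra0.
    move=> [_ [s' [Gs' /(constrained_leq (leq_maxl m m0))/hm ss'] _]].
    by exists s'.
  have : p (f (s None)) <> (Gg i).2 (s (Some i)).
    by move=> pg; apply: nDi; rewrite -gD; exists (s (Some i)).
  apply; apply: hX => A B nA nB.
  apply: contrapT => /nonemptyPn AB0.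
  move: nA; rewrite nbhsE => -[A' [oA' A'p] A'A].
  have [k1 hk1] := cf _ FN _ (cp _ _ (open_nbhs_nbhs (conj oA' A'p))).
  have [k2 hk2] := cg _ GN _ nB.
  have [m1 hm1] := @constrained_mkseq I r None k1.
  have [m2 hm2] := @constrained_mkseq I r (Some i) k2.
  pose m := maxn m0 (maxn m1 m2).
  have mm1 : (m1 <= m)%N by rewrite /m leq_max leq_max leqnn orbT.
  have mm2 : (m2 <= m)%N by rewrite /m leq_max leq_max leqnn !orbT.
  apply: (@fin m A'); first by rewrite leq_maxl.
  + exact: borel_set_open.
  + apply/seteqP; split => // x [A'x].
    move=> [s' [Gs' /(constrained_leq mm2)/hm2 ss'] gx].
    have : (A `&` B) x by split; [exact: A'A|rewrite -gx; exact: hk2].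
    by rewrite AB0.
  + move=> _ [_ [s' [Fs' /(constrained_leq mm1)/hm1 ss'] <-] <-].
    exact: hk1.
Qed.

(** * Polish spaces and their Borel subspaces *)

Lemma nested_compact (T : topologicalType) (C : nat -> set T) :
  compact (C 0%N) -> (forall n, closed (C n)) ->
  (forall m n, (m <= n)%N -> C n `<=` C m) -> (forall n, C n !=set0) ->
  exists z, forall n, C n z.
Proof.
move=> cC clC dC /choice[x Cx].
have [|z [_ zx]] := cC (x @ \oo) _.
  by exists 0%N => // n _; exact: dC (Cx n).
exists z => n; apply: clC => U nU.
have : (x @ \oo) (C n) by exists n => // m /= nm; exact: dC (Cx m).
by move=> /zx /(_ nU).
Qed.

Section mesh.
Context (R : realType).

Definition mesh (k : nat) : R := (k.+1%:R^-1)%R.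

Lemma mesh_gt0 k : (0 < mesh k)%R.
Proof. by rewrite invr_gt0 ltr0n. Qed.

Lemma mesh_le m n : (m <= n)%N -> (mesh n <= mesh m)%R.
Proof. by move=> mn; rewrite lef_pV2 ?posrE ?ltr0n// ler_nat. Qed.

Lemma mesh_small (e : R) : (0 < e)%R -> exists k, (mesh k < e)%R.
Proof.
move=> e0; have [N _ hN] := near_infty_natSinv_lt (PosNum e0).
by exists N; apply: hN => /=.
Qed.

End mesh.

Section polish_space.
Context (R : realType) (S : completePseudoMetricType R) (y0 : S).
Hypothesis polishS : polish S.

Lemma polish_dense_seq : exists y : nat -> S,
  forall z (e : R), (0 < e)%R -> exists n, ball z e (y n).
Proof.
have [_ [E /countable_injP[g injg] dE]] := polishS.
exists (fun n => xget y0 [set z | E z /\ g z = n]) => z e e0.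
have [|x [zx Ex]] := dE _ _ (@open_interior _ (ball z e)).
  by exists z; exact: nbhsx_ballx.
exists (g x); case: xgetP => [_ -> [Ex' gx]|/(_ x)]; last by case.
by rewrite (injg _ _ (mem_set Ex') (mem_set Ex) gx); exact: interior_subset zx.
Qed.

(** A point is coded by the indices of terms of a dense sequence that approach
    it at a rate fixed in advance: this makes the set of codes closed, and the
    limit a continuous function of the code. *)
Lemma polish_analytic : analytic [set: S].
Proof.
have [hS _] := polishS; have [y hy] := polish_dense_seq.
pose F := [set s : nat -> nat | forall i j, (i <= j)%N ->
  ball (y (s i)) (mesh R i) (y (s j))].
have /choice[f hf] : forall s, exists z : S,
      F s -> (fun i => y (s i)) @ \oo --> z.
  move=> s; have [Fs|] := pselect (F s); last by exists y0.
  have /cauchy_cvg/cvg_ex[z hz] : cauchy ((fun i => y (s i)) @ \oo); last by exists z.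
  apply: cauchy_exP => e e0; have [k ke] := mesh_small e0.
  exists (y (s k)); exists k => // j /= kj.
  by apply: le_ball (Fs _ _ kj); exact: ltW.
have fball s i : F s -> ball (y (s i)) (mesh R i + mesh R i)%R (f s).
  move=> Fs; have [N _ hN] := hf s Fs _ (nbhsx_ballx (f s) _ (mesh_gt0 R i)).
  have := hN (maxn N i) (leq_maxl _ _) => /= /ball_sym.
  exact/ball_triangle/Fs/leq_maxr.
exists F, f; split.
- move=> s hs i j ij; have [s' Fs' ss'] := hs j.+1.
  by rewrite !ss'//; exact: Fs'.
- move=> s Fs U /nbhs_ballP[e /= e0 eU].
  have [k ke] : exists k, (mesh R k < e / 4)%R.
    by apply: mesh_small; rewrite divr_gt0.
  exists k.+1 => s' Fs' ss'; apply: eU.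
  have := fball s' k Fs'; rewrite -ss'// => h.
  by apply: le_ball (ball_triangle (ball_sym (fball s k Fs)) h); lra.
- apply/seteqP; split=> // z _.
  have /choice[s hs] : forall i, exists n, ball z (mesh R i / 2)%R (y n).
    by move=> i; apply: hy; rewrite divr_gt0// mesh_gt0.
  have Fs : F s.
    move=> i j ij.
    have h := ball_triangle (ball_sym (hs i)) (hs j).
    by apply: le_ball h; have := mesh_le R ij; lra.
  exists s => //; apply: hS => A B nA nB.
  move: nB => /nbhs_ballP[e /= e0 eB].
  have [k ke] := mesh_small e0.
  have [N _ hN] := hf s Fs _ nA.
  exists (y (s (maxn N k))); split; first by apply: hN; exact: leq_maxl.
  apply: eB; apply: le_ball (hs (maxn N k)).
  by have := mesh_le R (leq_maxr N k); have := mesh_gt0 R (maxn N k); lra.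
Qed.

End polish_space.

Section borel_subspace.
Context (S : topologicalType) (D : set S) (x0 : D).

Lemma set_val_continuous : continuous (set_val : borel_sub x0 -> S).
Proof. exact: initial_continuous. Qed.

Lemma borel_sub_hausdorff : hausdorff_space S -> hausdorff_space (borel_sub x0).
Proof.
move=> hS p q pq; apply: val_inj; apply: hS => A B nA nB.
have [x [Ax Bx]] := pq _ _ (set_val_continuous nA) (set_val_continuous nB).
by exists (set_val x).
Qed.

Definition to_sub (z : S) : borel_sub x0 :=
  if pselect (D z) is left Dz then SigSub (mem_set Dz) else x0.

Lemma set_val_to_sub z : D z -> set_val (to_sub z) = z.
Proof. by rewrite /to_sub; case: pselect. Qed.

Lemma set_valP_sub (z : borel_sub x0) : D (set_val z).
Proof. by case: z => z Dz /=; exact: set_mem. Qed.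

Lemma to_sub_val (z : borel_sub x0) : to_sub (set_val z) = z.
Proof. by apply: val_inj; apply: set_val_to_sub; exact: set_valP_sub. Qed.

Lemma borel_sub_analytic : analytic D -> analytic [set: borel_sub x0].
Proof.
move=> [F [f [cF cf fD]]]; exists F, (to_sub \o f); split => //.
  have Df s : F s -> D (f s) by move=> Fs; rewrite -fD; exists s.
  move=> s Fs U; rewrite /= => -[V [[W oW <-] /= Wx WU]].
  rewrite set_val_to_sub in Wx; last exact: Df.
  have [k hk] := cf _ Fs _ (open_nbhs_nbhs (conj oW Wx)).
  exists k => s' Fs' ss'; apply: WU => /=.
  by rewrite set_val_to_sub; [exact: hk|exact: Df].
apply/seteqP; split => // z _.
have [s Fs fs] : (f @` F) (set_val z) by rewrite fD; exact: set_valP_sub.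
by exists s => //=; rewrite fs to_sub_val.
Qed.

End borel_subspace.

(** * Borel sets with compact sections *)

Lemma borel_set_bigcup_countType (T : topologicalType) (J : countType)
    (P : set J) (A : J -> set T) :
  (forall j, P j -> borel_set (A j)) -> borel_set (\bigcup_(j in P) A j).
Proof.
move=> bA; have -> : \bigcup_(j in P) A j = \bigcup_n
    (if unpickle n is Some j then if `[< P j >] then A j else set0 else set0).
  apply/seteqP; split => [x [j Pj Aj]|x [n _]].
    by exists (pickle j) => //; rewrite pickleK; case: asboolP.
  by case: unpickle => // j; case: asboolP => // Pj Aj; exists j.
apply: borel_set_bigcup => n; case: unpickle => [j|]; last exact: sigma_algebra0.
by case: asboolP => [/bA //|_]; exact: sigma_algebra0.
Qed.

Lemma borel_set_bigcap_countType (T : topologicalType) (J : countType)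
    (P : set J) (A : J -> set T) :
  (forall j, P j -> borel_set (A j)) -> borel_set (\bigcap_(j in P) A j).
Proof.
move=> bA; rewrite -[\bigcap_(_ in _) _]setCK setC_bigcap; apply: borel_setC.
by apply: borel_set_bigcup_countType => j /bA; exact: borel_setC.
Qed.

Lemma borel_setI (T : topologicalType) (A B : set T) :
  borel_set A -> borel_set B -> borel_set (A `&` B).
Proof.
move=> bA bB; have -> : A `&` B = \bigcap_n (if n is 0%N then A else B).
  apply/seteqP; split => [x [? ?] [|n]//|x h].
  by split; [exact: (h 0%N)|exact: (h 1%N)].
by apply: borel_set_bigcap => -[|n].
Qed.

Lemma borel_set_preimage (T X : topologicalType) (p : T -> X) (B : set X) :
  continuous p -> borel_set B -> borel_set (p @^-1` B).
Proof.
move=> cp; move: B; apply: (@smallest_sub _ _ _ [set B | borel_set (p @^-1` B)]).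
  split => [|A bA|A bA]; rewrite /= ?preimage_set0.
  - exact: sigma_algebra0.
  - by rewrite setTD; exact: borel_setC.
  - by rewrite preimage_bigcup; exact: borel_set_bigcup.
move=> U oU; apply: borel_set_open; by apply: open_comp => // ? _; exact: cp.
Qed.

Lemma ultra_bigcup (T : Type) (G : set_system T) (A : nat -> set T) m :
  UltraFilter G -> G (\bigcup_(i in `I_m) A i) -> exists i, G (A i).
Proof.
move=> uG; elim: m => [|m IH]; first by rewrite II0 bigcup_set0 => /filter_not_empty.
rewrite IIS bigcup_setU bigcup_set1 => GU.
have [|GC] := in_ultra_setVsetC (A m) uG; first by exists m.
apply: IH; apply: filterS (filterI GU GC) => x [[//|Ax] nAx].
by have := nAx Ax.
Qed.

Section compact_sections.
Context (R : realType) (X : topologicalType) (Y : completePseudoMetricType R).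
Context (y0 : Y).
Hypotheses (hX : hausdorff_space X) (aX : analytic [set: X]) (polishY : polish Y).

Lemma hausdorffY : hausdorff_space Y. Proof. by case: polishY. Qed.

Lemma cvg_prod_fst (x : X * Y) : fst @ x --> fst x.
Proof. by case: x => x y; exact: cvg_fst. Qed.

Lemma cvg_prod_snd (x : X * Y) : snd @ x --> snd x.
Proof. by case: x => x y; exact: cvg_snd. Qed.

Lemma borel_fst (B : set X) : borel_set B -> borel_set ((fst : X * Y -> X) @^-1` B).
Proof. by apply: borel_set_preimage => x; exact: cvg_prod_fst. Qed.

Lemma borel_snd (B : set Y) : borel_set B -> borel_set ((snd : X * Y -> Y) @^-1` B).
Proof. by apply: borel_set_preimage => x; exact: cvg_prod_snd. Qed.

Lemma hausdorff_prod : hausdorff_space (X * Y)%type.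
Proof.
move=> [x y] [x' y'] h; congr (_, _).
- apply: hX => A B nA nB.
  have [[z z'] [/= Az Bz]] := h _ _ (cvg_prod_fst (x := (x, y)) nA) (cvg_prod_fst (x := (x', y')) nB).
  by exists z.
- apply: hausdorffY => A B nA nB.
  have [[z z'] [/= Az Bz]] := h _ _ (cvg_prod_snd (x := (x, y)) nA) (cvg_prod_snd (x := (x', y')) nB).
  by exists z'.
Qed.

Lemma borel_analytic_prod (E : set (X * Y)) : borel_set E -> analytic E.
Proof.
apply: borel_analytic; first exact: hausdorff_prod.
rewrite -setXTT; apply: analytic_setX => //.
exact: (polish_analytic y0).
Qed.

Lemma borel_set_small_cover : exists Ob : nat -> nat -> set Y,
  [/\ forall i k, open (Ob i k), forall k y, exists i, Ob i k y &
   forall i k y y', Ob i k y -> Ob i k y' -> ball y (mesh R k + mesh R k) y'].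
Proof.
have [d hd] := polish_dense_seq y0 polishY.
exists (fun i k => (ball (d i) (mesh R k))^°); split.
- by move=> i k; exact: open_interior.
- move=> k y; have [|i hi] := hd y (mesh R k / 2)%R.
    by rewrite divr_gt0// mesh_gt0.
  exists i; apply/nbhs_ballP; exists (mesh R k / 2)%R => /=.
    by rewrite divr_gt0// mesh_gt0.
  by move=> z /(ball_triangle (ball_sym hi)); apply: le_ball; lra.
- move=> i k y y' /interior_subset/ball_sym h /interior_subset.
  exact: ball_triangle.
Qed.

(** A point [x] is outside the projection if and only if finitely many data
    prove it. By [borel_cover_analytic] the complement of [E] is a countable
    union of rectangles of the form [B i] by [Ob i], so it is enough that the
    section over [x] be covered by finitely many [Ob i] with [B i x]. For each
    scale [k], a second application gives Borel sets [H m] that cover [X],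
    such that over [H m] the section is contained in the first [m] balls. The
    intersection of these finite unions over all scales is totally bounded,
    and an ultrafilter argument shows that finitely many scales and finitely
    many [i] suffice. *)
Lemma borel_compact_proj (E : set (X * Y)) : borel_set E ->
  (forall x, compact [set y | E (x, y)]) -> borel_set (fst @` E).
Proof.
move=> bE cE; have [Ob [oO covO ballO]] := borel_set_small_cover.
have clE x : closed [set y | E (x, y)] by apply: compact_closed; [exact: hausdorffY|exact: cE].
(* The sections of the complement of E are open, which yields for each of its
   points a set Ob i that the section of E avoids. *)
have [B [bB BD BE]] : borel_covered fst
    (fun i : (nat * nat)%type => snd @^-1` Ob i.1 i.2) (~` E)
    (fun i => fst @` (E `&` snd @^-1` Ob i.1 i.2)).
  apply: borel_cover_analytic => //.
  - by move=> x; exact: cvg_prod_fst.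
  - by move=> i; apply: open_comp => // ? _; exact: cvg_prod_snd.
  - by apply: borel_analytic_prod; exact: borel_setC.
  - move=> i; apply: (analytic_image cvg_prod_fst); apply: borel_analytic_prod.
    apply: borel_setI => //; apply: borel_snd.
    exact: borel_set_open.
  - move=> [x y] Exy.
    have /nbhs_ballP[e /= e0 eE] : nbhs y (~` [set y | E (x, y)]).
      by apply: open_nbhs_nbhs; split => //; exact: closed_openC.
    have [k ke] : exists k, (mesh R k < e / 2)%R.
      by apply: mesh_small; rewrite divr_gt0.
    have [i Oy] := covO k y; exists (i, k); split => //=.
    move=> [[x' y'] [/= Exy' Oy'] xx']; rewrite xx' in Exy'.
    apply: (eE y') => //.
    by apply: le_ball (ballO _ _ _ _ Oy Oy'); lra.
(* By compactness finitely many small balls cover each section; over H m, the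
   first m of them do. *)
pose W m k := \bigcup_(i in `I_m) Ob i k.
have oW m k : open (W m k) by apply: bigcup_open.
have /choice[H hH] : forall k, exists H : nat -> set X, [/\ forall m, borel_set (H m),
    forall m x y, H m x -> E (x, y) -> W m k y & forall x, exists m, H m x].
  move=> k.
  have [H [bH HD HE]] : borel_covered id (fun _ : nat => [set: X]) [set: X]
      (fun m => fst @` (E `&` snd @^-1` ~` W m k)).
    apply: borel_cover_analytic => //.
    - by move=> x; exact: cvg_id.
    - by move=> _; exact: openT.
    - move=> m; apply: (analytic_image cvg_prod_fst); apply: borel_analytic_prod.
      apply: borel_setI => //; apply: borel_snd.
      by apply: borel_setC; exact: borel_set_open.
    - move=> x _; apply: contrapT => /forallNP hx.
      have [|m|m n mn y|m|y hy] :=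
        @nested_compact _ (fun m => [set y | E (x, y)] `&` ~` W m k).
      + by apply: compact_closedI => //; exact: open_closedC.
      + by apply: closedI => //; exact: open_closedC.
      + move=> [Exy nW]; split => // -[i /= im Oi]; apply: nW; exists i => //=.
        exact: leq_trans mn.
      + have /not_andP[nT|/contrapT[[x' y] [Exy Wy] /= xx']] := hx m.
          by exfalso; exact: nT.
        by exists y; rewrite -xx'.
      + have [i Oi] := covO k y; have [_] := hy i.+1.
        by apply; exists i => /=.
  exists H; split => //.
  - move=> m x y Hx Exy; apply: contrapT => nW.
    have : (H m `&` fst @` (E `&` snd @^-1` ~` W m k)) x.
      by split => //; exists (x, y).
    by rewrite HD.
  - by move=> x; have [m [_ ?]] := HE x Logic.I; exists m.
(* The finite data that prove a section empty range over a countable type and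
   do not depend on x. *)
pose Good (ls : (seq nat * seq (nat * nat))%type) := forall z,
  (forall j, (j < size ls.1)%N -> W (nth 0%N ls.1 j) j z) ->
  exists i, i \in ls.2 /\ Ob i.1 i.2 z.
rewrite -[_ @` _]setCK; apply: borel_setC.
have -> : ~` (fst @` E) = \bigcup_(ls in [set ls | Good ls])
    ((\bigcap_(j in [set j | (j < size ls.1)%N]) H j (nth 0%N ls.1 j)) `&`
     (\bigcap_(i in [set i | i \in ls.2]) B i)).
  apply/seteqP; split => x; last first.
    move=> [[l s] /= gls [Hx Bx]] [[x' y] Exy /= xx']; rewrite xx' in Exy.
    have [|i [si Oi]] := gls y.
      by move=> j /= jl; have [_ hj _] := hH j; apply: hj Exy; exact: Hx.
    have : (B i `&` fst @` (E `&` snd @^-1` Ob i.1 i.2)) x.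
      by split; [exact: Bx|exists (x, y)].
    by rewrite BD.
  move=> nx.
  have /choice[m hm] : forall j, exists m, H j m x.
    by move=> j; have [_ _ h] := hH j; exact: h.
  have hB z : exists i, Ob i.1 i.2 z /\ B i x.
    by apply: (BE (x, z)) => Exz; apply: nx; exists (x, z).
  pose s k : seq (nat * nat) :=
    [seq i <- pmap unpickle (iota 0 k) | `[< B i x >]].
  suff [k gk] : exists k, Good (mkseq m k, s k).
    exists (mkseq m k, s k) => //; split => [j /=|i /=].
      by rewrite size_mkseq => jk; rewrite nth_mkseq.
    by rewrite mem_filter => /andP[/asboolP].
  apply: contrapT => /forallNP nG.
  have /choice[z hz] : forall k, exists z,
      (forall j, (j < k)%N -> W (m j) j z) /\
      (forall i, (pickle i < k)%N -> B i x -> ~ Ob i.1 i.2 z).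
    move=> k; have /existsNP[z /not_implyP[hz1 hz2]] := nG k; exists z; split.
      by move=> j jk; have := hz1 j; rewrite /= size_mkseq nth_mkseq//; exact.
    move=> i ik Bi Oi; apply: hz2; exists i; split => //=.
    rewrite mem_filter; apply/andP; split; first exact/asboolP.
    rewrite mem_pmap; apply/mapP; exists (pickle i); last by rewrite pickleK.
    by rewrite mem_iota.
  (* The points z k escape more and more open sets, while an ultrafilter finer
     than the sequence is Cauchy, being confined at every scale. *)
  have [G [uG zG]] := @ultraFilterLemma _ (z @ \oo) _.
  have /cauchy_cvg/cvg_ex[z' Gz'] : cauchy G.
    apply: cauchy_exP => e e0.
    have [k ke] : exists k, (mesh R k < e / 2)%R.
      by apply: mesh_small; rewrite divr_gt0.
    have : G (W (m k) k).
      by apply: zG; exists k.+1 => // n /= kn; have [h _] := hz n; exact: h.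
    move=> /ultra_bigcup[i Gi]; have /filter_ex[y Oy] := Gi.
    exists y; apply: filterS Gi => y' Oy'.
    by apply: le_ball (ballO _ _ _ _ Oy Oy'); lra.
  have [i [Oi Bi]] := hB z'.
  have GO : G (Ob i.1 i.2) by apply: Gz'; exact: open_nbhs_nbhs.
  have GC : G (~` Ob i.1 i.2).
    by apply: zG; exists (pickle i).+1 => // n /= kn; have [_ h] := hz n; exact: h.
  have [y [Oy nOy]] : exists y, (Ob i.1 i.2 `&` ~` Ob i.1 i.2) y.
    by apply: (@filter_ex _ G); exact: filterI.
  exact: nOy.
apply: borel_set_bigcup_countType => -[l s] _; apply: borel_setI.
  by apply: borel_set_bigcap_countType => j _; have [h _ _] := hH j; exact: h.
by apply: borel_set_bigcap_countType => j _; exact: bB.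
Qed.

(** Each section is cut down to its intersection with the first set that it
    meets in a countable cover by small closed sets. The index of this set is
    a Borel function because, by [borel_compact_proj], the projections [P i]
    are Borel. Two points in the closure of a ball of radius [mesh R k] are
    within [4 * mesh R k] of each other. *)
Lemma thin_compact_sections k (E : set (X * Y)) : borel_set E ->
  (forall x, compact [set y | E (x, y)]) ->
  exists E' : set (X * Y), [/\ borel_set E',
    forall x, compact [set y | E' (x, y)], E' `<=` E,
    fst @` E' = fst @` E &
    forall x y y', E' (x, y) -> E' (x, y') ->
      ball y (mesh R k *+ 4)%R y'].
Proof.
move=> bE cE; have [Ob [oO covO ballO]] := borel_set_small_cover.
pose K i := closure (Ob i k).
have bK i : borel_set (E `&` snd @^-1` K i).
  apply: borel_setI => //; apply: borel_snd.
  by apply: borel_set_closed; exact: closed_closure.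
pose P i := fst @` (E `&` snd @^-1` K i).
have bP i : borel_set (P i).
  apply: borel_compact_proj => // x.
  by apply: (@compact_closedI _ [set y | E (x, y)] (K i)) => //; exact: closed_closure.
pose Q i := P i `&` \bigcap_(j in [set j | (j < i)%N]) ~` P j.
have bQ i : borel_set (Q i).
  apply: borel_setI => //; apply: borel_set_bigcap_countType => j _.
  exact: borel_setC.
have Quniq x i j : Q i x -> Q j x -> i = j.
  move=> [Pi hi] [Pj hj]; apply/eqP; rewrite eqn_leq.
  apply/andP; split; rewrite leqNgt; apply/negP => ij.
    exact: (hi j).
  exact: (hj i).
pose E' := \bigcup_i (E `&` snd @^-1` K i `&` fst @^-1` Q i).
have E'sec x i : Q i x -> [set y | E' (x, y)] = [set y | E (x, y)] `&` K i.
  move=> Qi; apply/seteqP; split => [y [j _ [[/= Exy Ky] Qj]]|y [Exy Ky]].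
    by rewrite (Quniq _ _ _ Qi Qj).
  by exists i.
exists E'; split.
- apply: borel_set_bigcup => i; apply: borel_setI => //.
  exact: borel_fst.
- move=> x; have [[i Qi]|nQ] := pselect (exists i, Q i x).
    by rewrite (E'sec _ _ Qi); apply: compact_closedI => //; exact: closed_closure.
  rewrite (_ : [set _ | _] = set0); first exact: compact0.
  by apply/seteqP; split => // y [i _ [_ Qi]]; apply: nQ; exists i.
- by move=> [x y] [i _ [[]]].
- apply/seteqP; split => [_ [[x y] [i _ [[Exy _] _]] <-]|_ [[x y] Exy <-]].
    by exists (x, y).
  have exP : exists i, `[< P i x >].
    have [i Oi] := covO k y; exists i; apply/asboolP; exists (x, y) => //.
    by split => //; exact: subset_closure.
  have := ex_minnP exP => -[i /asboolP Pi mi].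
  have [[x' y'] [/= Exy' Ky'] xx'] := Pi; rewrite xx' in Exy'.
  exists (x, y') => //; exists i => //; split => //; split => //= j /= ji Pj.
  have := mi j; rewrite leqNgt ji => /(_ _)/negP; apply => //.
  exact/asboolP.
- move=> x y y' [i _ [[_ Ky] Qi]] [j _ [[_ Ky'] Qj]].
  rewrite /= -(Quniq _ _ _ Qi Qj) in Ky'.
  have [z [Oz yz]] := Ky _ (nbhsx_ballx y _ (mesh_gt0 R k)).
  have [z' [Oz' yz']] := Ky' _ (nbhsx_ballx y' _ (mesh_gt0 R k)).
  apply: le_ball (ball_triangle (ball_triangle yz (ballO _ _ _ _ Oz Oz'))
    (ball_sym yz')).
  by rewrite -mulr_natr; lra.
Qed.

(** Thinning at all scales leaves exactly one point in each nonempty section.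
    Compactness makes the projection commute with the intersection over the
    scales, which shows that the selected point depends on [x] in a Borel way.
    *)
Lemma borel_compact_selection (E : set (X * Y)) : borel_set E ->
  (forall x, compact [set y | E (x, y)]) ->
  exists phi : X -> Y,
    (forall x, (fst @` E) x -> E (x, phi x)) /\
    (forall C, closed C -> borel_set (fst @` E `&` phi @^-1` C)).
Proof.
move=> bE cE.
have /choice[nxt hnxt] : forall kE : (nat * set (X * Y))%type,
    exists E' : set (X * Y), borel_set kE.2 ->
    (forall x, compact [set y | kE.2 (x, y)]) -> [/\ borel_set E',
    forall x, compact [set y | E' (x, y)], E' `<=` kE.2,
    fst @` E' = fst @` kE.2 &
    forall x y y', E' (x, y) -> E' (x, y') ->
      ball y (mesh R kE.1 *+ 4)%R y'].
  move=> [k E1]; have [[b1 c1]|h] := pselect (borel_set E1 /\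
      forall x, compact [set y | E1 (x, y)]).
    by have [E' ?] := thin_compact_sections k b1 c1; exists E'.
  by exists set0 => b1 c1; exfalso; apply: h.
pose E_ := fix E_ k := if k is k'.+1 then nxt (k', E_ k') else E.
have hE k : borel_set (E_ k) /\ forall x, compact [set y | E_ k (x, y)].
  elim: k => [//|k [bk ck]].
  by have [? ? _ _ _] := hnxt (k, E_ k) bk ck.
have ES k : E_ k.+1 `<=` E_ k.
  by have [bk ck] := hE k; have [_ _ ? _ _] := hnxt (k, E_ k) bk ck.
have Edec m n : (m <= n)%N -> E_ n `<=` E_ m.
  move=> /subnK <-; elim: (n - m)%N => // d IH.
  exact: subset_trans (ES _) IH.
have Eproj k : fst @` E_ k = fst @` E.
  elim: k => // k <-.
  by have [bk ck] := hE k; have [_ _ _ ? _] := hnxt (k, E_ k) bk ck.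
have Euniq x y y' : (forall k, E_ k (x, y)) -> (forall k, E_ k (x, y')) -> y = y'.
  move=> hy hy'; apply: hausdorffY => A B /nbhs_ballP[e /= e0 eA] /nbhs_singleton By'.
  exists y'; split => //; apply: eA.
  have [k ke] : exists k, (mesh R k < e / 4)%R.
    by apply: mesh_small; rewrite divr_gt0.
  have [bk ck] := hE k; have [_ _ _ _ h] := hnxt (k, E_ k) bk ck.
  have := h _ _ _ (hy k.+1) (hy' k.+1) => /=.
  by apply: le_ball; rewrite -mulr_natr; lra.
have Enested x (C : set Y) : closed C -> (forall k, exists y, E_ k (x, y) /\ C y) ->
    exists y, forall k, E_ k (x, y) /\ C y.
  move=> cC h; apply: (@nested_compact _ (fun k => [set y | E_ k (x, y)] `&` C)).
  - by apply: compact_closedI => //; have [_] := hE 0%N.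
  - by move=> n; apply: closedI => //; apply: compact_closed; [exact: hausdorffY|]; have [_] := hE n.
  - by move=> m n mn y [/(Edec _ _ mn) ? ?].
  - exact: h.
have /choice[phi hphi] : forall x, exists y, (fst @` E) x -> forall k, E_ k (x, y).
  move=> x; have [Ex|] := pselect ((fst @` E) x); last by exists y0.
  have [||y hy] := @Enested x setT; [exact: closedT| |].
    by move=> k; move: Ex; rewrite -(Eproj k) => -[[x' y] ? /= <-]; exists y.
  by exists y => _ k; have [] := hy k.
exists phi; split; first by move=> x /hphi/(_ 0%N).
move=> C cC.
have -> : fst @` E `&` phi @^-1` C = \bigcap_k (fst @` (E_ k `&` snd @^-1` C)).
  apply/seteqP; split => [x [Ex Cx] k _|x hx].
    by exists (x, phi x) => //; split => //; exact: hphi.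
  have [|y hy] := @Enested x C cC.
    by move=> k; have [[x' y] [Exy Cy] /= <-] := hx k Logic.I; exists y.
  have Ex : (fst @` E) x by exists (x, y) => //; have [] := hy 0%N.
  split => //=; rewrite (@Euniq x (phi x) y); first by have [] := hy 0%N.
    exact: hphi.
  by move=> k; have [] := hy k.
apply: borel_set_bigcap => k; have [bk ck] := hE k.
apply: borel_compact_proj => [|x].
  by apply: borel_setI => //; apply: borel_snd; exact: borel_set_closed.
exact: (@compact_closedI _ [set y | E_ k (x, y)] C).
Qed.

End compact_sections.

(** * Measurable selection of minimisers *)

Lemma measurable_fun_le_set d (T : measurableType d) (R : realType)
    (f : T -> \bar R) :
  (forall r : R, measurable [set x | f x <= r%:E]) -> measurable_fun setT f.
Proof.
move=> h; apply: (measurability (@ErealGenOInfty.G R)).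
  exact: ErealGenOInfty.measurableE.
move=> _ [_ [r ->] <-]; rewrite setTI.
rewrite (_ : _ @^-1` _ = ~` [set x | f x <= r%:E]).
  by apply: measurableC; exact: h.
apply/seteqP; split => x /=; rewrite in_itv/= andbT ltNge; first by move/negP.
by move/negP.
Qed.

Section minimisers.
Context (R : realType) (SX SA : completePseudoMetricType R) (polishX : polish SX)
  (polishA : polish SA) (DX : set SX) (DA : set SA) (borelX : borel_set DX)
  (borelA : borel_set DA) (x0 : DX) (a0 : DA).

Local Notation X := (borel_sub x0).
Local Notation A := (borel_sub a0).

Lemma borel_set_val (B : set A) : measurable B -> borel_set (set_val @` B).
Proof.
move: B; apply: (@smallest_sub _ _ _ [set B | borel_set (set_val @` B)]).
  split => [|B bB|B bB] /=.
  - by rewrite image_set0; exact: sigma_algebra0.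
  - rewrite (_ : _ @` _ = DA `&` ~` (set_val @` B)).
      by apply: borel_setI => //; exact: borel_setC.
    apply/seteqP; split => [_ [a [_ Ba] <-]|z [Dz Bz]].
      split; first exact: set_valP_sub.
      by move=> [b Bb /val_inj ba]; rewrite ba in Bb.
    exists (to_sub a0 z); last exact: set_val_to_sub.
    by split => // Bz'; apply: Bz; exists (to_sub a0 z) => //; exact: set_val_to_sub.
  - by rewrite image_bigcup; exact: borel_set_bigcup.
move=> U [W oW <-]; rewrite /= (_ : _ @` _ = W `&` DA).
  by apply: borel_setI => //; exact: borel_set_open.
apply/seteqP; split => [_ [a Wa <-]|z [Wz Dz]].
  by split => //; exact: set_valP_sub.
by exists (to_sub a0 z); rewrite /= set_val_to_sub.
Qed.

Let embed (xa : X * A) : X * SA := (xa.1, set_val xa.2).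

Lemma embed_inj : injective embed.
Proof. by move=> [x a] [y b] [-> /val_inj ->]. Qed.

Lemma borel_set_embed (E : set (X * A)) : measurable E -> borel_set (embed @` E).
Proof.
rewrite measurable_prod_measurableType; move: E.
apply: (@smallest_sub _ _ _ [set E | borel_set (embed @` E)]).
  split => [|E bE|E bE] /=.
  - by rewrite image_set0; exact: sigma_algebra0.
  - rewrite (_ : _ @` _ = snd @^-1` DA `&` ~` (embed @` E)).
      by apply: borel_setI; [exact: borel_snd|exact: borel_setC].
    apply/seteqP; split => [_ [xa [_ Exa] <-]|[x z] [Dz Ez]].
      split; first exact: set_valP_sub.
      by move=> [yb Eyb /embed_inj yx]; rewrite yx in Eyb.
    have e : embed (x, to_sub a0 z) = (x, z) by rewrite /embed /= set_val_to_sub.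
    exists (x, to_sub a0 z) => //.
    by split => // E'; apply: Ez; exists (x, to_sub a0 z).
  - by rewrite image_bigcup; exact: borel_set_bigcup.
move=> _ [B mB [C mC] <-].
rewrite /= (_ : _ @` _ = fst @^-1` B `&` snd @^-1` (set_val @` C)).
  by apply: borel_setI; [exact: borel_fst|apply: borel_snd; exact: borel_set_val].
apply/seteqP; split => [_ [[x a] [/= Bx Ca] <-]|[x z] [/= Bx [a Ca <-]]].
  by split => //; exists a.
by exists (x, a).
Qed.

(** The selection theorem for a complete second factor applies to the image in
    [SA], where compact sections stay compact and Borel sets stay Borel
    because [DA] is Borel. *)
Lemma measurable_compact_selection (E : set (X * A)) : measurable E ->
  (forall x, compact [set a | E (x, a)]) ->
  measurable (fst @` E) /\ exists phi : X -> A, measurable_fun setT phi /\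
    forall x, (fst @` E) x -> E (x, phi x).
Proof.
move=> mE cE; have [hX _] := polishX.
have bE := borel_set_embed mE.
have hX' : hausdorff_space X by exact: borel_sub_hausdorff.
have aX : analytic [set: X].
  apply: borel_sub_analytic; apply: borel_analytic => //.
  exact: (polish_analytic (set_val x0)).
have projE : fst @` (embed @` E) = fst @` E.
  by rewrite image_comp.
have cE' x : compact [set z | (embed @` E) (x, z)].
  rewrite (_ : [set z | _] = set_val @` [set a | E (x, a)]).
    apply: continuous_compact => //; apply: continuous_subspaceT.
    exact: set_val_continuous.
  apply/seteqP; split => [z [[y a] Exa [<- <-]]|_ [a Exa <-]]; first by exists a.
  by exists (x, a).
have mP : measurable (fst @` E).
  by rewrite -projE; exact: (borel_compact_proj (set_val a0)).
split => //.
have [phi [hphi bphi]] := borel_compact_selection (set_val a0) hX' aX polishA bE cE'.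
exists (fun x => if pselect ((fst @` E) x) then to_sub a0 (phi x) else a0); split.
  apply: (measurability (@open A)) => //.
  move=> _ [_ [W oW <-] <-]; rewrite setTI.
  rewrite (_ : _ @^-1` _ = (fst @` E `\` (fst @` E `&` phi @^-1` (~` W))) `|`
     (if pselect (W (set_val a0)) then ~` (fst @` E) else set0)).
    apply: measurableU.
      by apply: measurableD => //; rewrite -projE; apply: bphi; exact: open_closedC.
    by case: pselect => ?; [exact: measurableC|exact: measurable0].
  apply/seteqP; split => x /=; case: (pselect ([set x.1 | x in E] x)) => Px /=.
  - move: (Px); rewrite -{1}projE => /hphi[[y a] Eya [yx ax]].
    rewrite -ax to_sub_val => Wa; left; split => //.
    by move=> [_ /(_ Wa)].
  - by move=> W0; right; case: pselect.
  - case=> [[_ h]|]; last by case: pselect.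
    move: (Px); rewrite -{1}projE => /hphi[[y a] Eya [yx ax]].
    rewrite -ax to_sub_val; apply: contrapT => nW; apply: h; split => //.
    by rewrite -ax.
  - by case=> [[/Px]|]; last case: pselect.
move=> x Px; case: pselect => [?|/(_ Px)//] /=.
move: Px; rewrite -projE => /hphi[[y a] Eya [yx ax]].
by rewrite -ax to_sub_val -yx.
Qed.

Lemma compact_le_closed (f : A -> \bar R) : inf_compact f ->
  forall l : R, closed [set a | f a <= l%:E].
Proof.
move=> cf l; apply: compact_closed => //; apply: borel_sub_hausdorff.
by case: polishA.
Qed.

(** The level sets are nonempty, compact and nested. This is what allows
    minimisation over the actions to be exchanged with increasing limits. *)
Lemma inf_compact_common_point (F : nat -> A -> \bar R) (l : nat -> R) :
  (forall n, inf_compact (F n)) -> (forall m n a, (m <= n)%N -> F m a <= F n a) ->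
  (forall m n, (m <= n)%N -> (l n <= l m)%R) ->
  (forall n, exists a, F n a <= (l n)%:E) -> exists a, forall n, F n a <= (l n)%:E.
Proof.
move=> cF dF dl hF; apply: (@nested_compact _ (fun n => [set a | F n a <= (l n)%:E])) => //.
- exact: cF.
- by move=> n; exact: (compact_le_closed (cF n)).
- move=> m n mn a /= h; apply: le_trans (dF _ _ _ mn) _; apply: le_trans h _.
  by rewrite lee_fin; exact: dl.
Qed.

Lemma inf_compact_attained (f : A -> \bar R) :
  (forall a, 0 <= f a) -> inf_compact f -> exists a, forall b, f a <= f b.
Proof.
move=> f0 cf; have [foo|] := eqVneq (ereal_inf (range f)) +oo.
  exists a0 => b; suff -> : f b = +oo by rewrite leey.
  by apply/eqP; rewrite -leye_eq -foo; apply: ereal_inf_lbound; exists b.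
move=> foo; have inf0 : 0 <= ereal_inf (range f).
  by apply/ereal_infP => _ [a _ <-].
have [r rE] : exists r : R, ereal_inf (range f) = r%:E.
  by case: (ereal_inf _) foo inf0 => // r _ _; exists r.
have [||||a ha] := @inf_compact_common_point (fun=> f) (fun n => r + n.+1%:R^-1)%R.
- by [].
- by [].
- by move=> m n mn; rewrite lerD2l lef_pV2 ?posrE ?ltr0n// ler_nat.
- move=> n; have [||_ [a _ <-] fa] := @lb_ereal_inf_adherent _ (range f) (n.+1%:R^-1)%R.
  + by rewrite invr_gt0 ltr0n.
  + by rewrite rE.
  + by exists a; apply: ltW; rewrite EFinD -rE.
exists a => b; apply: (@le_trans _ _ r%:E); last first.
  by rewrite -rE; apply: ereal_inf_lbound; exists b.
apply/lee_addgt0Pr => e e0.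
have [k ke] := mesh_small e0; apply: le_trans (ha k) _.
by rewrite -EFinD lee_fin lerD2l; exact: ltW.
Qed.

(** The sublevel sets of the minimum are the projections of those of [f],
    hence measurable. Where the minimum is finite, the set of its minimisers
    is a section of a measurable set and is compact; elsewhere all actions are
    minimisers. *)
Lemma measurable_minimiser (f : X * A -> \bar R) :
  measurable_fun setT f -> (forall xa, 0 <= f xa) ->
  (forall x, inf_compact (fun a => f (x, a))) ->
  exists phi : X -> A, [/\ measurable_fun setT phi,
    measurable_fun setT (fun x => f (x, phi x)) &
    forall x a, f (x, phi x) <= f (x, a)].
Proof.
move=> mf f0 cf.
have /choice[psi hpsi] : forall x, exists a, forall b, f (x, a) <= f (x, b).
  by move=> x; exact: inf_compact_attained.
pose m x := f (x, psi x).
have mm : measurable_fun setT m.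
  apply: measurable_fun_le_set => r.
  rewrite (_ : [set x | _] = fst @` [set xa | f xa <= r%:E]).
    have [] // := @measurable_compact_selection [set xa | f xa <= r%:E].
      by rewrite -[X in measurable X]setTI; exact: emeasurable_fun_infty_c.
    by move=> x; exact: cf.
  apply/seteqP; split => [x mx|_ [[x a] h <-]]; first by exists (x, psi x).
  exact: le_trans (hpsi x a) h.
(* Points with m x = +oo are discarded, as compactness may fail there. *)
pose E := [set xa : X * A | f xa <= m xa.1] `&` [set xa | m xa.1 < +oo].
have mE : measurable E.
  have mm1 : measurable_fun setT (fun xa : X * A => m xa.1).
    by apply: measurableT_comp.
  apply: measurableI; rewrite -[X in measurable X]setTI.
    exact: measurable_lee.
  exact: emeasurable_fun_infty_o.
have [|mP [phi [mphi hphi]]] := measurable_compact_selection mE.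
  move=> x; case E1 : (m x) => [r| |].
  - rewrite (_ : [set a | _] = [set a | f (x, a) <= r%:E]); first exact: cf.
    apply/seteqP; split => [a [/=]|a fa]; first by rewrite E1.
    by split => /=; rewrite E1// ltry.
  - rewrite (_ : [set a | _] = set0); first exact: compact0.
    by apply/seteqP; split => // a [_ /=]; rewrite E1 ltxx.
  - by have := f0 (x, psi x); rewrite -/(m x) E1.
have phim x : f (x, phi x) = m x.
  have [moo|mfin] := eqVneq (m x) +oo.
    by apply/eqP; rewrite moo -leye_eq -moo; exact: hpsi.
  apply/eqP; rewrite eq_le hpsi andbT.
  have /hphi[] // : (fst @` E) x.
  by exists (x, psi x) => //; split => //=; rewrite ltey.
exists phi; split => //.
  by rewrite (_ : (fun x => _) = m)//; apply/funext.
by move=> x a; rewrite phim; exact: hpsi.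
Qed.

End minimisers.

(** * The Ionescu Tulcea theorem *)

Lemma integral_kcomp_noparam d1 d2 d3 (X : measurableType d1)
    (Y : measurableType d2) (Z : measurableType d3) (R : realType)
    (l : R.-spker X ~> Y) (k : R.-spker Y ~> Z) (x : X) (f : Z -> \bar R) :
  (forall z, 0 <= f z) -> measurable_fun setT f ->
  \int[mkcomp_noparam l k x]_z f z = \int[l x]_y \int[k y]_z f z.
Proof.
move=> f0 mf.
rewrite -[RHS](@integral_kcomp _ _ _ _ _ _ _ l (kernel.kernel_snd k) x f f0 mf).
exact: (@eq_measure_integral _ _ _ _ (mkcomp l (kernel.kernel_snd k) x)).
Qed.

Section past_determined.
Context (dX dA : measure_display) (X : measurableType dX)
  (A : measurableType dA).
Local Notation W := (trajectory X A).

Definition past_determined (S : Type) (n : nat) (f : W -> S) : Prop :=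
  forall w w' : nat -> X * A, agree n w w' -> f w = f w'.

Lemma past_determined_leq (S : Type) m n (f : W -> S) :
  (m <= n)%N -> past_determined m f -> past_determined n f.
Proof. by move=> mn pf w w' /(agree_leq mn); exact: pf. Qed.

Definition cylinder : set (set W) :=
  [set C | measurable C /\ exists n, past_determined n C].

Lemma cylinder0 : cylinder set0.
Proof. by split; [exact: measurable0|exists 0%N]. Qed.

Lemma cylinderU : setU_closed cylinder.
Proof.
move=> C D [mC [m pC]] [mD [n pD]]; split; first exact: measurableU.
exists (maxn m n) => w w' ww'; rewrite /setU /mkset.
by rewrite (past_determined_leq (leq_maxl m n) pC ww')
  (past_determined_leq (leq_maxr m n) pD ww').
Qed.

Lemma cylinderC : setC_closed cylinder.
Proof.
move=> C [mC [m pC]]; split; first exact: measurableC.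
by exists m => w w' ww'; rewrite /setC /mkset (pC _ _ ww').
Qed.

(** A copy of [W] that carries the algebra of cylinders, from which the
    measure is extended, instead of the product sigma-algebra. *)
Definition cylinder_space : Type := W.

HB.instance Definition _ := Pointed.copy cylinder_space W.
HB.instance Definition _ := @isAlgebraOfSets.Build (sigma_display cylinder)
  cylinder_space cylinder cylinder0 cylinderU cylinderC.

Lemma measurable_sub_sigma_cylinder : @measurable _ W `<=`
  @measurable _ (g_sigma_algebraType (@measurable _ cylinder_space)).
Proof.
apply: smallest_sub; first exact: smallest_sigma_algebra.
move=> _ [t [B mB ->]]; apply: sub_sigma_algebra; split.
  by apply: sub_sigma_algebra; exists t; exists B.
by exists t.+1 => w w' ww'; rewrite /preimage /mkset ww'.
Qed.

End past_determined.

Section ionescu_tulcea.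
Context (R : realType) (dX dA : measure_display) (X : measurableType dX)
  (A : measurableType dA).
Local Notation W := (trajectory X A).

Variables (U : nat -> R.-pker W ~> W) (w0 : W).

(** [U t] redraws the coordinates from [t] on and keeps the earlier ones. This
    is expressed through functions that vanish on the trajectories with the
    same past, since the set of these trajectories may fail to be measurable.
    *)
Hypothesis U_keeps_past : forall t (w : W) (f : W -> \bar R),
  measurable_fun setT f -> (forall w, 0 <= f w) ->
  (forall w' : W, agree t w w' -> f w' = 0) -> \int[U t w]_y f y = 0.

Hypothesis U_adapted : forall t (w w' : W) (f : W -> \bar R),
  measurable_fun setT f -> (forall w, 0 <= f w) -> past_determined t.+1 f ->
  agree t w w' -> \int[U t w]_y f y = \int[U t w']_y f y.

(** Coordinates are redrawn one after the other in a full trajectory, so that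
    the laws of initial segments of all lengths live on the single space [W].
    *)
Fixpoint steps (t m : nat) : R.-spker W ~> W :=
  if m is m'.+1 then mkcomp_noparam (U t) (steps t.+1 m')
  else kdirac (@measurable_id _ W setT).

Lemma stepsS t m w B : steps t m.+1 w B = \int[U t w]_y steps t.+1 m y B.
Proof. by []. Qed.

Lemma measurable_steps t m B : measurable B ->
  measurable_fun setT (fun w => steps t m w B).
Proof. exact: measurable_kernel. Qed.

Lemma steps_tail t m w B : measurable B ->
  steps t m.+1 w B = \int[steps t m w]_y U (t + m)%N y B.
Proof.
move=> mB; elim: m t w => [|m IH] t w.
  rewrite stepsS addn0 /= /kdirac integral_dirac//; last exact: measurable_kernel.
  rewrite diracT mul1e.
  transitivity (\int[U t w]_y (\1_B y)%:E); first exact: eq_integral.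
  by rewrite integral_indic// setIT.
rewrite stepsS [RHS]integral_kcomp_noparam//; last exact: measurable_kernel.
by apply: eq_integral => y _; rewrite IH addSnnS.
Qed.

Lemma prob_kernelT t w : U t w setT = 1.
Proof. exact: prob_kernel. Qed.

Lemma U_past_set t (w : W) B : measurable B -> past_determined t B ->
  U t w B = \d_w B.
Proof.
have zero (C : set W) : measurable C -> past_determined t C -> ~ C w -> U t w C = 0.
  move=> mC pC nC; have := @U_keeps_past t w (fun w => (\1_C w)%:E).
  rewrite integral_indic// setIT; apply.
  - by apply/measurable_EFinP; exact: measurable_indic.
  - by move=> y; rewrite lee_fin.
  - move=> w' ww'; rewrite indicE memNset// => Cw'; apply: nC.
    by rewrite (pC _ _ ww').
move=> mB pB; rewrite diracE; have [Bw|nB] := pselect (B w); last first.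
  by rewrite memNset// zero.
rewrite mem_set//= -(prob_kernelT t w) -(setUv B) measureU//.
- rewrite [X in _ = _ + X]zero ?adde0//; first exact: measurableC.
  by move=> y y' yy'; rewrite /setC /mkset (pB _ _ yy').
- exact: measurableC.
- by rewrite setICr.
Qed.

Lemma steps_past t m k w B : measurable B -> past_determined (t + m) B ->
  steps t (m + k) w B = steps t m w B.
Proof.
move=> mB; elim: m t w => [|m IH] t w pB; last first.
  rewrite addSn !stepsS; apply: eq_integral => y _.
  by apply: IH; rewrite addSn -addnS.
rewrite addn0 in pB; rewrite add0n.
elim: k t w pB => // k IH t w pB; rewrite stepsS.
transitivity (\int[U t w]_y steps t.+1 0 y B).
  by apply: eq_integral => y _; apply: IH; exact: past_determined_leq pB.
rewrite /= -(U_past_set w mB pB).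
transitivity (\int[U t w]_y (\1_B y)%:E); first exact: eq_integral.
by rewrite integral_indic// setIT.
Qed.

Lemma steps_adapted t m B : measurable B -> past_determined (t + m) B ->
  past_determined t (fun w => steps t m w B).
Proof.
move=> mB; elim: m t => [|m IH] t pB w w' ww'.
  rewrite addn0 in pB; rewrite /= !diracE; congr ((nat_of_bool _)%:R%:E).
  by apply/idP/idP => /set_mem h; apply/mem_set; move: h; rewrite (pB _ _ ww').
rewrite !stepsS; apply: U_adapted ww' => //; first exact: measurable_steps.
by apply: IH; rewrite addSn -addnS.
Qed.

Lemma steps_le1 t m w B : measurable B -> steps t m w B <= 1.
Proof.
move=> mB; apply: le_trans (sprob_kernel_le1 (steps t m) w).
by apply: le_measure; rewrite ?inE.
Qed.

(** This is the continuity at the empty set, on which the theorem rests. The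
    limit [l t w] of the conditional probabilities of [C n] given the
    coordinates of [w] before time [t] satisfies [l t w = \int[U t w]_y l t.+1
    y]. If it is positive, it therefore remains so for some choice of
    coordinate [t]. Starting from a positive [l 0 w0], these choices build a
    trajectory that belongs to all the [C n]. *)
Lemma steps_cvg0 (C : nat -> set W) (N : nat -> nat) :
  (forall n, measurable (C n)) -> (forall n, past_determined (N n) (C n)) ->
  (forall m n, (m <= n)%N -> C n `<=` C m) -> \bigcap_n C n = set0 ->
  steps 0 (N n) w0 (C n) @[n --> \oo] --> 0.
Proof.
move=> mC pC dC C0.
pose g n t w := steps t (N n - t) w (C n).
have pCt n t : past_determined (t + (N n - t)) (C n).
  by apply: past_determined_leq (pC n); rewrite -leq_subLR.
have gS n t w : g n t w = \int[U t w]_y g n t.+1 y.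
  rewrite /g; have [tN|Nt] := ltnP t (N n).
    by rewrite -[(N n - t)%N]prednK ?subn_gt0// -subnS.
  have Nt0 : (N n - t = 0)%N by apply/eqP; rewrite subn_eq0.
  have -> : (N n - t.+1 = 0)%N by rewrite subnS Nt0.
  have := @steps_past t 0 1 w (C n) (mC n); rewrite Nt0 addn0 => <-//.
  exact: past_determined_leq (pC n).
have gdec n m t w : (n <= m)%N -> g m t w <= g n t w.
  move=> nm; pose M := maxn (N n) (N m).
  have e k : (N k <= M)%N -> g k t w = steps t (M - t) w (C k).
    move=> kM; rewrite /g.
    rewrite -(@steps_past t (N k - t) (M - t - (N k - t)))//.
    by rewrite subnKC// leq_sub2r.
  rewrite !e ?leq_maxl ?leq_maxr//.
  by apply: le_measure; rewrite ?inE//; exact: dC.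
have g0 n t w : 0 <= g n t w by exact: measure_ge0.
have mg n t : measurable_fun setT (g n t) by exact: measurable_steps.
pose l t w := ereal_inf (range (fun n => g n t w)).
have gl t w : (fun n => g n t w) @ \oo --> l t w.
  by apply: ereal_nonincreasing_cvgn => n m nm; exact: gdec.
have l0 t w : 0 <= l t w by apply/ereal_infP => _ [n _ <-].
have ml t : measurable_fun setT (l t).
  by apply: (emeasurable_fun_cvg (fun n => g n t)).
have lU t w : l t w = \int[U t w]_y l t.+1 y.
  have h : (fun n => \int[U t w]_y g n t.+1 y) @ \oo --> \int[U t w]_y l t.+1 y.
    apply: (@dominated_cvg _ _ _ _ _ _ _ _ (cst 1)) => //.
    - apply/integrableP; split => //.
      under eq_integral do rewrite abse1.
      by rewrite integral_cst//= prob_kernelT mule1 ltry.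
    - by move=> n y _; rewrite gee0_abs//; exact: steps_le1.
  have := gl t w; under eq_fun do rewrite gS.
  by move=> h'; have := cvg_unique _ h' h; exact.
have step t w : 0 < l t w -> exists2 w' : W, agree t w w' & 0 < l t.+1 w'.
  move=> lpos; apply: contrapT => /forall2NP h.
  move: lpos; rewrite lU U_keeps_past ?ltxx// => w' ww'.
  have [//|] := h w'; move/negP; rewrite -leNgt => l0'.
  by apply/eqP; rewrite eq_le l0' l0.
have [l00|lpos] := eqVneq (l 0%N w0) 0.
  rewrite -l00; have := gl 0%N w0; rewrite /g.
  by under eq_fun do rewrite subn0.
have {}lpos : 0 < l 0%N w0 by rewrite lt0e lpos l0.
have /choice[nxt hnxt] : forall tw : nat * W, exists w' : W,
    0 < l tw.1 tw.2 -> agree tw.1 tw.2 w' /\ 0 < l tw.1.+1 w'.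
  move=> [t w]; have [/step[w' ? ?]|] := pselect (0 < l t w); first by exists w'.
  by exists w.
pose ws := fix ws t := if t is t'.+1 then nxt (t', ws t') else w0.
have wsl t : 0 < l t (ws t).
  by elim: t => // t IH; have [] := hnxt (t, ws t) IH.
have wsS t : agree t (ws t) (ws t.+1).
  by have [] := hnxt (t, ws t) (wsl t).
pose wlim : nat -> X * A := fun i => (ws i.+1 : nat -> X * A) i.
have wsE t : agree t (ws t) wlim.
  move=> i; elim: t => // t IH; rewrite ltnS leq_eqVlt => /orP[/eqP -> //|it].
  by rewrite -IH//; apply/esym; exact: wsS.
have : (\bigcap_n C n) wlim.
  move=> n _; have : 0 < g n (N n) wlim.
    have p := @steps_adapted (N n) (N n - N n) _ (mC n) (pCt n (N n)).
    rewrite /g -(p _ _ (wsE (N n))).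
    apply: lt_le_trans (wsl (N n)) _.
    by apply: ereal_inf_lbound; exists n.
  rewrite /g subnn /= diracE; have [/set_mem //|] := boolP (wlim \in C n).
  by rewrite ltxx.
by rewrite C0.
Qed.

Definition cylinder_content (C : set (cylinder_space X A)) : \bar R :=
  if pselect (exists n, past_determined n (C : set W)) is left h
  then steps 0 (projT1 (cid h)) w0 C else 0.

Lemma cylinder_contentE n (C : set W) : measurable C -> past_determined n C ->
  cylinder_content C = steps 0 n w0 C.
Proof.
move=> mC pC; rewrite /cylinder_content; case: pselect => [h|[]]; last by exists n.
case: (cid h) => m pm /=.
have e k : (k <= maxn m n)%N -> past_determined k C ->
    steps 0 k w0 C = steps 0 (maxn m n) w0 C.
  move=> kM pk; rewrite -(@steps_past 0 k (maxn m n - k))// subnKC//.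
by rewrite (e m) ?leq_maxl// -(e n)// leq_maxr.
Qed.

Lemma cylinder_content0 : cylinder_content set0 = 0.
Proof. by rewrite (@cylinder_contentE 0)//; exact: measure0. Qed.

Lemma cylinder_content_ge0 C : 0 <= cylinder_content C.
Proof. by rewrite /cylinder_content; case: pselect => // h; exact: measure_ge0. Qed.

Lemma cylinder_contentU (C D : set W) : cylinder C -> cylinder D ->
  C `&` D = set0 ->
  cylinder_content (C `|` D) = cylinder_content C + cylinder_content D.
Proof.
move=> [mC [m pC]] [mD [n pD]] CD.
have {}pC := past_determined_leq (leq_maxl m n) pC.
have {}pD := past_determined_leq (leq_maxr m n) pD.
rewrite (cylinder_contentE mC pC) (cylinder_contentE mD pD).
rewrite (@cylinder_contentE (maxn m n)) ?measureU//; first exact: measurableU.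
by move=> w w' ww'; rewrite /setU /mkset (pC _ _ ww') (pD _ _ ww').
Qed.

(** The remainders of a countable disjoint union of cylinders decrease to the
    empty set, so [steps_cvg0] applies to them. *)
Lemma cylinder_content_sigma_additive :
  semi_sigma_additive cylinder_content.
Proof.
move=> F mF tF mUF.
pose Rn n : set W := (\bigcup_n F n) `\` (\big[setU/set0]_(i < n) F i).
have mR n : cylinder (Rn n).
  have : @measurable _ (cylinder_space X A) (Rn n).
    by apply: measurableD => //; apply: bigsetU_measurable.
  by [].
have RS n : Rn n = F n `|` Rn n.+1.
  rewrite /Rn big_ord_recr /=; apply/seteqP; split => w.
    move=> [Uw nw]; have [Fw|nF] := pselect (F n w); [by left|right].
    by split => // -[].
  move=> [Fw|[Uw nw]]; last by split => // h; apply: nw; left.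
  split; first by exists n.
  rewrite -bigcup_mkord => -[i /= ltin Fi].
  have /trivIsetP /(_ i n Logic.I Logic.I) := tF.
  rewrite (ltn_eqF ltin) => /(_ isT) FF.
  by have : (F i `&` F n) w by []; rewrite FF.
have FR n : F n `&` Rn n.+1 = set0.
  apply/seteqP; split => // w [Fw [_ nw]]; apply: nw.
  by rewrite big_ord_recr; right.
have decomp n : cylinder_content (\bigcup_n F n) =
    \sum_(0 <= i < n) cylinder_content (F i) + cylinder_content (Rn n).
  elim: n => [|n IH]; first by rewrite big_nil add0e /Rn big_ord0 setD0.
  rewrite IH RS cylinder_contentU//; last exact: mF.
  by rewrite big_nat_recr//= addeA.
have fin C : cylinder C -> cylinder_content C \is a fin_num.
  move=> [mC [n pC]]; rewrite (cylinder_contentE mC pC) ge0_fin_numE ?measure_ge0//.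
  by apply: le_lt_trans (steps_le1 0 n w0 mC) _; rewrite ltry.
have sumE n : \sum_(0 <= i < n) cylinder_content (F i) =
    cylinder_content (\bigcup_n F n) - cylinder_content (Rn n).
  by rewrite (decomp n) addeK//; exact: fin.
suff R0 : cylinder_content (Rn n) @[n --> \oo] --> 0.
  have : (cylinder_content (\bigcup_n F n) - cylinder_content (Rn n)) @[n --> \oo]
      --> cylinder_content (\bigcup_n F n) - 0.
    apply: cvgeB => //; last exact: cvg_cst.
    by rewrite fin_num_adde_defl.
  by rewrite sube0; apply: cvg_trans; apply: near_eq_cvg; near=> n; rewrite sumE.
have /choice[N hN] : forall n, exists k, past_determined k (Rn n).
  by move=> n; have [_] := mR n.
have mR' n : measurable (Rn n : set W) by have [] := mR n.
under eq_fun do rewrite (cylinder_contentE (mR' _) (hN _)).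
apply: steps_cvg0 => //.
- move=> m n mn w [Uw nw]; split => //; rewrite -bigcup_mkord => -[i /= im Fi].
  apply: nw; rewrite -bigcup_mkord; exists i => //=; exact: leq_trans mn.
- apply/seteqP; split => // w h.
  have [[i _ Fi] _] := h 0%N Logic.I.
  have [_] := h i.+1 Logic.I; apply.
  by rewrite -bigcup_mkord; exists i => /=.
Unshelve. all: by end_near. Qed.

HB.instance Definition _ := isMeasure.Build _ (cylinder_space X A) R
  cylinder_content cylinder_content0 cylinder_content_ge0
  cylinder_content_sigma_additive.

Theorem ionescu_tulcea_extension : exists P : probability W R,
  forall n B, measurable B -> past_determined n B -> P B = steps 0 n w0 B.
Proof.
pose mu : {measure set (cylinder_space X A) -> \bar R} := cylinder_content.
pose ext := measure_extension mu.
pose P (B : set W) : \bar R := ext B.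
have PE n B : measurable B -> past_determined n B -> P B = steps 0 n w0 B.
  move=> mB pB; rewrite /P /ext /measure_extension measurable_mu_extE.
    exact: cylinder_contentE.
  by split => //; exists n.
have P0 : P set0 = 0 by exact: measure0.
have Pge0 B : 0 <= P B by exact: measure_ge0.
have Psigma : semi_sigma_additive P.
  move=> F mF tF mUF; apply: (@measure_semi_sigma_additive _ _ _ ext) => //.
  - by move=> i; exact: measurable_sub_sigma_cylinder.
  - exact: measurable_sub_sigma_cylinder.
pose m1 := isMeasure.Build _ W R P P0 Pge0 Psigma.
pose Pm : {measure set W -> \bar R} := HB.pack P m1.
have PT : Pm setT = 1 by rewrite /= (PE 0%N)//= diracT.
pose m2 := Measure_isProbability.Build _ W R Pm PT.
pose Pp : probability W R := HB.pack P m1 m2.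
by exists Pp.
Qed.

End ionescu_tulcea.

(** * Existence of the strategic measure *)

Section kernel_pullback.
Context d1 d2 d3 (Z : measurableType d1) (X : measurableType d2)
  (Y : measurableType d3) (R : realType) (k : R.-pker X ~> Y) (f : Z -> X)
  (mf : measurable_fun setT f).

(** The proof of measurability is an argument of the function because the
    kernel instance has to recover it from the term. *)
Definition kernel_pullback (mf : measurable_fun setT f) (z : Z) :
  {measure set Y -> \bar R} := k (f z).

Let kernel_pullback_measurable U : measurable U ->
  measurable_fun setT (kernel_pullback mf ^~ U).
Proof. by move=> mU; exact: (measurableT_comp (measurable_kernel k U mU) mf). Qed.

HB.instance Definition _ := isKernel.Build _ _ _ _ R (kernel_pullback mf)
  kernel_pullback_measurable.

Let kernel_pullback_prob z : kernel_pullback mf z setT = 1.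
Proof. exact: prob_kernel. Qed.

HB.instance Definition _ := Kernel_isProbability.Build _ _ _ _ R
  (kernel_pullback mf) kernel_pullback_prob.

End kernel_pullback.

Section measurable_trajectory.
Context (dX dA : measure_display) (X : measurableType dX)
  (A : measurableType dA).
Local Notation W := (trajectory X A).

Lemma measurable_coordinate t : measurable_fun setT (fun w : W => w t).
Proof.
move=> _ B mB; rewrite setTI; apply: sub_sigma_algebra.
by exists t; exists B.
Qed.

Lemma measurable_to_trajectory d (Z : measurableType d) (f : Z -> W) :
  (forall t, measurable_fun setT (fun z => f z t)) -> measurable_fun setT f.
Proof.
have h : @measurable _ W = <<s (@coordinate_cylinders _ _ X A) >> by [].
move=> mf; apply: (measurability _ h).
move=> _ [_ [t [B mB ->]] <-]; rewrite setTI.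
by rewrite -[X in measurable X]setTI; exact: mf.
Qed.

Lemma measurable_state t : measurable_fun setT (fun w : W => state w t).
Proof. exact: (measurableT_comp measurable_fst (measurable_coordinate t)). Qed.

Lemma measurable_action t : measurable_fun setT (fun w : W => action w t).
Proof. exact: (measurableT_comp measurable_snd (measurable_coordinate t)). Qed.

Definition past (t : nat) (w : W) : t.-tuple (X * A) := [tuple w i | i < t].

Lemma measurable_past t : measurable_fun setT (past t).
Proof.
apply/measurable_fun_tnthP => i.
rewrite (_ : _ \o _ = fun w : W => w i); first exact: measurable_coordinate.
by apply/funext => w; rewrite /= tnth_mktuple.
Qed.

Lemma measurable_history_of t : measurable_fun setT (@history_of _ _ X A t).
Proof.
apply: measurable_fun_pair; first exact: measurable_past.
exact: measurable_state.
Qed.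

Definition update (t : nat) (wxa : W * X * A) : W :=
  fun i => if i == t then (wxa.1.2, wxa.2) else wxa.1.1 i.

Lemma measurable_update t : measurable_fun setT (update t).
Proof.
apply: measurable_to_trajectory => i; rewrite /update; case: eqP => _.
  apply: measurable_fun_pair => //.
  exact: (measurableT_comp measurable_snd measurable_fst).
apply: (@measurableT_comp _ _ _ _ _ _ (fun w : W => w i) setT
  (fun z : W * X * A => z.1.1)); first exact: measurable_coordinate.
exact: (measurableT_comp measurable_fst measurable_fst).
Qed.

Lemma update_agree t (w : W) x a : agree t w (update t (w, x, a)).
Proof. by move=> i it; rewrite /update /= ltn_eqF. Qed.

Lemma update_eq t (w : W) x a : update t (w, x, a) t = (x, a).
Proof. by rewrite /update eqxx. Qed.

Lemma past_agree t (w w' : W) : agree t w w' -> past t w = past t w'.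
Proof. by move=> ww'; apply: eq_mktuple => i; exact: ww'. Qed.

End measurable_trajectory.

Section strategic.
Context (R : realType) (dX dA : measure_display) (X : measurableType dX)
  (A : measurableType dA).
Local Notation W := (trajectory X A).
Variables (q : R.-pker (X * A) ~> X) (pi : policy R X A) (x : X).

Definition state_kernel (t : nat) : R.-pker W ~> X :=
  if t is s.+1 then kernel_pullback q (@measurable_coordinate _ _ X A s)
  else kdirac (@measurable_cst _ _ W X setT x).

Lemma measurable_extend_past t :
  measurable_fun setT (fun wx : W * X => (past t wx.1, wx.2) : history X A t).
Proof.
apply: measurable_fun_pair => //.
exact: (measurableT_comp (@measurable_past _ _ X A _) measurable_fst).
Qed.

Definition action_kernel (t : nat) : R.-pker (W * X) ~> A :=
  kernel_pullback (pi t) (@measurable_extend_past t).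

Definition step (t : nat) : W -> {measure set W -> \bar R} :=
  mkcomp (state_kernel t)
    (mkcomp (action_kernel t) (kdirac (@measurable_update _ _ X A t))).

HB.instance Definition _ t := SFiniteKernel.copy (step t)
  (mkcomp (state_kernel t)
    (mkcomp (action_kernel t) (kdirac (@measurable_update _ _ X A t)))).

Lemma integral_step t w (f : W -> \bar R) :
  (forall w, 0 <= f w) -> measurable_fun setT f ->
  \int[step t w]_y f y = \int[state_kernel t w]_y
    \int[pi t (past t w, y)]_a f (update t (w, y, a)).
Proof.
move=> f0 mf; rewrite [LHS]integral_kcomp//; apply: eq_integral => y _.
rewrite [LHS]integral_kcomp//; apply: eq_integral => a _.
by rewrite /kdirac integral_dirac// diracT mul1e.
Qed.

Let step_prob t w : step t w setT = 1.
Proof.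
have := @integral_step t w (cst 1) (fun=> lee01) (@measurable_cst _ _ _ _ _ _).
rewrite integral_cst//= mul1e => ->.
under eq_integral do rewrite integral_cst//= prob_kernel mul1e.
by rewrite integral_cst//= prob_kernel mul1e.
Qed.

HB.instance Definition _ t := Kernel_isProbability.Build _ _ _ _ R (step t)
  (step_prob t).

Lemma history_of_update t (w : W) y a :
  history_of t (update t (w, y, a)) = (past t w, y).
Proof.
rewrite /history_of /state update_eq; congr (_, _).
by apply/esym/past_agree; exact: update_agree.
Qed.

Lemma step_keeps_past t (w : W) (f : W -> \bar R) :
  measurable_fun setT f -> (forall w, 0 <= f w) ->
  (forall w' : W, agree t w w' -> f w' = 0) -> \int[step t w]_y f y = 0.
Proof.
move=> mf f0 fz; rewrite integral_step// integral0_eq// => y _.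
by rewrite integral0_eq// => a _; apply: fz; exact: update_agree.
Qed.

Lemma step_adapted t (w w' : W) (f : W -> \bar R) :
  measurable_fun setT f -> (forall w, 0 <= f w) -> past_determined t.+1 f ->
  agree t w w' -> \int[step t w]_y f y = \int[step t w']_y f y.
Proof.
move=> mf f0 pf ww'; rewrite !integral_step// (past_agree ww').
have -> : state_kernel t w = state_kernel t w'.
  by case: t ww' {pf} => //= t ww'; rewrite /kernel_pullback ww'.
apply: eq_integral => y _; apply: eq_integral => a _; apply: pf => i.
rewrite ltnS leq_eqVlt => /orP[/eqP ->|it]; first by rewrite !update_eq.
by rewrite /update /= ltn_eqF//; exact: ww'.
Qed.

(** The three defining conditions concern events that depend on finitely many
    coordinates, whose probabilities are those computed by finitely many
    steps. *)
Theorem strategic_measure_exists :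
  exists P : probability W R, is_strategic_measure q pi x P.
Proof.
pose w0 : W := point.
have [P PS] := ionescu_tulcea_extension w0 step_keeps_past step_adapted.
pose S n := steps step 0 n w0.
(* Truncation after time n turns the identity on cylinders into an equality of
     laws. *)
have intS n (f : W -> \bar R) : (forall w, 0 <= f w) -> measurable_fun setT f ->
    past_determined n f -> \int[P]_w f w = \int[S n]_w f w.
  move=> f0 mf pf.
  pose r (w : W) : W := fun i => if (i < n)%N then w i else w0 i.
  have mr : measurable_fun setT r.
    apply: measurable_to_trajectory => t.
    have : measurable_fun setT (fun w : W => if (t < n)%N then w t else w0 t).
      by case: (t < n)%N; [exact: measurable_coordinate|exact: measurable_cst].
    by [].
  have rE (w : W) : agree n (r w) w by move=> i; rewrite /r => ->.
  have fr : f = f \o r by apply/funext => w; apply: pf; apply: agree_sym; exact: rE.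
  rewrite fr.
  rewrite -[LHS](@ge0_integral_pushforward _ _ _ _ _ _ mr P setT f)//.
  rewrite -[RHS](@ge0_integral_pushforward _ _ _ _ _ _ mr (S n) setT f)//.
  apply: eq_measure_integral => B mB _; rewrite /pushforward.
  apply: PS; first by rewrite -[X in measurable X]setTI; exact: mr.
  move=> w w' ww'; rewrite /preimage /mkset; congr (B _).
  by apply/funext => i; rewrite /r; case: ifP => // /ww'.
have intSS n (f : W -> \bar R) : (forall w, 0 <= f w) -> measurable_fun setT f ->
    past_determined n.+1 f ->
    \int[P]_w f w = \int[S n]_w \int[step n w]_y f y.
  move=> f0 mf pf; rewrite (intS n.+1)// -integral_kcomp_noparam//.
  apply: eq_measure_integral => B mB _.
  exact: steps_tail.
have PE (E : set W) : measurable E -> P E = \int[P]_w (\1_E w)%:E.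
  by move=> mE; rewrite integral_indic// setIT.
have mindic (E : set W) : measurable E -> measurable_fun setT (fun w => (\1_E w)%:E : \bar R).
  by move=> mE; apply/measurable_EFinP; exact: measurable_indic.
have indic0 (E : set W) w : 0 <= (\1_E w)%:E :> \bar R by rewrite lee_fin.
have memE (T1 T2 : Type) (E : set T1) (F : set T2) u v : (E u <-> F v) ->
    (u \in E) = (v \in F).
  by move=> h; apply/idP/idP => /set_mem/h/mem_set.
have intcst t h (r : \bar R) : \int[pi t h]_a r = r.
  by rewrite integral_cst//= prob_kernel mule1.
exists P; split.
- move=> B mB; set E := [set w | _].
  have mE : measurable E.
    by rewrite -[X in measurable X]setTI; exact: measurable_state.
  rewrite PE// (intSS 0%N)//; last 2 first.
  + exact: mindic.
  + by move=> w w' ww'; rewrite !indicE (@memE _ _ E E w w')// /E /state /= ww'.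
  transitivity (\int[S 0%N]_w \d_x B).
    apply: eq_integral => w _; rewrite integral_step//; last exact: mindic.
    transitivity (\int[state_kernel 0%N w]_y (\1_B y)%:E).
      apply: eq_integral => y _; rewrite -[RHS](intcst 0%N (past 0 w, y)).
      apply: eq_integral => a _; rewrite !indicE.
      by rewrite (@memE _ _ E B (update 0 (w, y, a)) y)// /E /state /= update_eq.
    by rewrite integral_indic// setIT.
  by rewrite integral_cst//= diracT mule1.
- move=> t H C mH mC; set E := [set w | _]; set D := [set w | _].
  have mD : measurable D.
    by rewrite -[X in measurable X]setTI; exact: measurable_history_of.
  have mE : measurable E.
    rewrite (_ : E = D `&` [set w : W | C (action w t)])//.
    apply: measurableI => //.
    by rewrite -[X in measurable X]setTI; exact: measurable_action.
  have mg : measurable_fun setT (fun w : W => pi t (history_of t w) C).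
    exact: (measurableT_comp (measurable_kernel (pi t) C mC)
      (@measurable_history_of _ _ X A t)).
  have hist_agree (w w' : W) : agree t.+1 w w' -> history_of t w = history_of t w'.
    move=> ww'; rewrite /history_of /state ww'//; congr (_, _).
    by apply: past_agree; exact: agree_leq ww'.
  rewrite PE// (intSS t)//; last 2 first.
  + exact: mindic.
  + move=> w w' ww'; rewrite !indicE (@memE _ _ E E w w')// /E /=.
    by rewrite (hist_agree _ _ ww') /action ww'.
  rewrite [RHS]integral_mkcond (intSS t); last 3 first.
  + by move=> w; rewrite patchE; case: ifP.
  + by apply/(measurable_restrictT _ mD); exact: measurable_funTS.
  + move=> w w' ww'; rewrite !patchE (@memE _ _ D D w w').
      by rewrite (hist_agree _ _ ww').
    by rewrite /D /= (hist_agree _ _ ww').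
  apply: eq_integral => w _; rewrite !integral_step//; last 3 first.
  + by move=> w'; rewrite patchE; case: ifP.
  + by apply/(measurable_restrictT _ mD); exact: measurable_funTS.
  + exact: mindic.
  apply: eq_integral => y _.
  have [Hy|nHy] := pselect (H (past t w, y)); last first.
    rewrite !integral0_eq// => a _.
      by rewrite patchE memNset// /D /= history_of_update.
    by rewrite indicE memNset// => -[]; rewrite history_of_update.
  transitivity (\int[pi t (past t w, y)]_a (\1_C a)%:E).
    apply: eq_integral => a _; rewrite !indicE (@memE _ _ E C _ a)//.
    by rewrite /E /action /= history_of_update update_eq; split => [[]|].
  rewrite integral_indic// setIT -[LHS](intcst t (past t w, y)).
  apply: eq_integral => a _.
  by rewrite patchE mem_set /= ?history_of_update// /D /= history_of_update.
- move=> t G B mG mB; set E := [set w | _]; set D := [set w | _].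
  have mha : measurable_fun setT (fun w : W => (history_of t w, action w t)).
    apply: measurable_fun_pair; first exact: measurable_history_of.
    exact: measurable_action.
  have mD : measurable D by rewrite -[X in measurable X]setTI; exact: mha.
  have mE : measurable E.
    rewrite (_ : E = D `&` [set w : W | B (state w t.+1)])//.
    apply: measurableI => //.
    by rewrite -[X in measurable X]setTI; exact: measurable_state.
  have mg : measurable_fun setT (fun w : W => q (state w t, action w t) B).
    apply: (measurableT_comp (measurable_kernel q B mB)).
    by apply: measurable_fun_pair; [exact: measurable_state|exact: measurable_action].
  have ha_agree (w w' : W) : agree t.+1 w w' ->
      (history_of t w, action w t) = (history_of t w', action w' t).
    move=> ww'; rewrite /history_of /state /action ww'//; congr (_, _, _).
    by apply: past_agree; exact: agree_leq ww'.
  rewrite PE// (intSS t.+1)//; last 2 first.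
  + exact: mindic.
  + move=> w w' ww'; rewrite !indicE (@memE _ _ E E w w')// /E /state /=.
    by rewrite (ha_agree _ _ (agree_leq (leqnSn _) ww')) ww'.
  rewrite [RHS]integral_mkcond (intS t.+1); last 3 first.
  + by move=> w; rewrite patchE; case: ifP.
  + by apply/(measurable_restrictT _ mD); exact: measurable_funTS.
  + move=> w w' ww'; rewrite !patchE (@memE _ _ D D w w').
      by have [_ _] := ha_agree _ _ ww'; rewrite /state /action ww'.
    by rewrite /D /= (ha_agree _ _ ww').
  apply: eq_integral => w _; rewrite integral_step//; last exact: mindic.
  have upd (y : X) (a : A) : E (update t.+1 (w, y, a)) <-> D w /\ B y.
    rewrite /E /D /state /= update_eq.
    by rewrite -(ha_agree w)//; exact: update_agree.
  rewrite patchE; case: ifPn => [/set_mem Dw|/negP nD].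
    transitivity (\int[q (state w t, action w t)]_y (\1_B y)%:E).
      rewrite /= /kernel_pullback /state /action -surjective_pairing.
      apply: eq_integral => y _; rewrite -[RHS](intcst t.+1 (past t.+1 w, y)).
      apply: eq_integral => a _; rewrite !indicE (@memE _ _ E B _ y)// upd.
      by split => [[]|].
    by rewrite integral_indic// setIT.
  rewrite integral0_eq// => y _; rewrite integral0_eq// => a _.
  by rewrite indicE memNset// => /upd[Dw _]; apply: nD; exact: mem_set.
Qed.

End strategic.

(** * Expectations along a trajectory *)

Section expectations.
Context (R : realType) (dX dA : measure_display) (X : measurableType dX)
  (A : measurableType dA).
Local Notation W := (trajectory X A).
Variables (q : R.-pker (X * A) ~> X).

Lemma strategic_measureP (pi : policy R X A) x :
  is_strategic_measure q pi x (strategic_measure q pi x).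
Proof. exact: getPex (strategic_measure_exists q pi x). Qed.

Lemma measurable_state_action t :
  measurable_fun setT (fun w : W => (state w t, action w t)).
Proof.
by apply: measurable_fun_pair; [exact: measurable_state|exact: measurable_action].
Qed.

Lemma integral_state0 (pi : policy R X A) x (V : X -> \bar R) :
  (forall y, 0 <= V y) -> measurable_fun setT V ->
  \int[strategic_measure q pi x]_w V (state w 0%N) = V x.
Proof.
move=> V0 mV; have [P0 _ _] := strategic_measureP pi x.
rewrite -[LHS](@ge0_integral_pushforward _ _ _ _ _ _ (@measurable_state _ _ X A 0%N)
  (strategic_measure q pi x) setT V)//.
transitivity (\int[@dirac _ X x R]_y V y).
  apply: eq_measure_integral => [|mf B mB _]; first exact: measurable_state.
  exact: (P0 B mB).
by rewrite integral_dirac// diracT mul1e.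
Qed.

Lemma integral_next_state (pi : policy R X A) x t (V : X -> \bar R) :
  (forall y, 0 <= V y) -> measurable_fun setT V ->
  \int[strategic_measure q pi x]_w V (state w t.+1) =
  \int[strategic_measure q pi x]_w \int[q (state w t, action w t)]_y V y.
Proof.
move=> V0 mV; have [_ _ Pq] := strategic_measureP pi x.
pose l := kprobability (@measurable_cst _ _ unit (pprobability W R) setT
  (strategic_measure q pi x)).
pose k := kernel_pullback q (@measurable_state_action t).
rewrite -[RHS](@integral_kcomp_noparam _ _ _ _ _ _ _ l k tt V V0 mV).
rewrite -[LHS](@ge0_integral_pushforward _ _ _ _ _ _ (@measurable_state _ _ X A t.+1)
  (strategic_measure q pi x) setT V)//.
apply: eq_measure_integral => [|mf B mB _]; first exact: measurable_state.
have := Pq t setT B measurableT mB.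
rewrite (_ : [set w : W | _ /\ _] = (fun w : W => state w t.+1) @^-1` B).
  by rewrite (_ : [set w : W | setT _] = setT).
by apply/seteqP; split => [w []|w ?]; last by split.
Qed.

(** The laws of [(x_t, a_t)] and [(x_t, phi x_t)] agree on measurable
    rectangles, by the condition on conditional laws of actions, hence
    everywhere. *)
Lemma integral_deterministic (phi : {mfun X >-> A}) x t (g : X * A -> \bar R) :
  (forall y, 0 <= g y) -> measurable_fun setT g ->
  \int[strategic_measure q (deterministic_policy R phi) x]_w
    g (state w t, action w t) =
  \int[strategic_measure q (deterministic_policy R phi) x]_w
    g (state w t, phi (state w t)).
Proof.
move=> g0 mg; set P := strategic_measure _ _ _.
have [_ Pa _] := strategic_measureP (deterministic_policy R phi) x.
have mphi : measurable_fun setT (fun w : W => (state w t, phi (state w t))).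
  apply: measurable_fun_pair; first exact: measurable_state.
  by apply: measurableT_comp => //; exact: measurable_state.
rewrite -[LHS](@ge0_integral_pushforward _ _ _ _ _ _ (@measurable_state_action t)
  P setT g)//.
rewrite -[RHS](@ge0_integral_pushforward _ _ _ _ _ _ mphi P setT g)//.
apply: eq_measure_integral => [|mf B mB _]; first exact: measurable_state_action.
pose G := [set B `*` C | B in @measurable _ X & C in @measurable _ A].
apply: (@measure_unique _ _ _ G (fun=> setT)) => //.
- by rewrite measurable_prod_measurableType.
- move=> _ _ [B1 mB1 [C1 mC1 <-]] [B2 mB2 [C2 mC2 <-]].
  exists (B1 `&` B2); first exact: measurableI.
  by exists (C1 `&` C2); [exact: measurableI|rewrite setXI].
- by move=> _; exists setT => //; exists setT => //; rewrite setXTT.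
- by rewrite bigcup_const//; exists 0%N.
- move=> _ [B1 mB1 [C1 mC1 <-]]; rewrite /= /pushforward.
  have mH : measurable [set h : history X A t | B1 h.2].
    by rewrite -[X in measurable X]setTI; exact: measurable_snd.
  have := Pa t _ C1 mH mC1.
  set D := [set w | _ (history_of t w)].
  have mD : measurable D.
    by rewrite -[X in measurable X]setTI; exact: measurable_state.
  rewrite (_ : [set w | _ /\ _] =
    (fun w : W => (state w t, action w t)) @^-1` (B1 `*` C1))// => ->.
  have mphis : measurable_fun setT (fun w : W => phi (state w t)).
    by apply: measurableT_comp => //; exact: measurable_state.
  transitivity (\int[P]_(w in D) (\1_((fun w : W => phi (state w t)) @^-1` C1) w)%:E).
    by apply: eq_integral => w _; rewrite /= /kdirac diracE indicE.
  rewrite integral_indic//; last by rewrite -[X in measurable X]setTI; exact: mphis.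
  by congr (P _); apply/seteqP; split => w [].
- move=> _; rewrite /= /pushforward preimage_setT.
  by apply: le_lt_trans (probability_le1 P measurableT) _; rewrite ltry.
Qed.

End expectations.

(** * Discounted and average costs of a policy *)

(** For negative [r] the point is the case of an infinite integral of [f]: the
    positive part of [f + r] then has an infinite integral too, and its
    negative part is bounded by [- r]. *)
Lemma integral_shift d (T : measurableType d) (R : realType)
    (P : {measure set T -> \bar R}) (f : T -> \bar R) (r : R) : P setT = 1 ->
  measurable_fun setT f -> (forall x, 0 <= f x) ->
  \int[P]_x (f x + r%:E) = \int[P]_x f x + r%:E.
Proof.
move=> P1 mf f0.
have cstE (s : R) : \int[P]_x s%:E = s%:E by rewrite integral_cst//= P1 mule1.
have [r0|r0] := leP 0%R r.
  by rewrite ge0_integralD// cstE.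
have [foo|] := eqVneq (\int[P]_x f x) +oo; last first.
  move=> ffin; rewrite integralD//= ?cstE//.
  - apply/integrableP; split => //; under eq_integral do rewrite gee0_abs//.
    by rewrite ltey.
  - apply/integrableP; split => //.
    by rewrite integral_cst//= P1 mule1 ltry.
have mg : measurable_fun setT (fun x => f x + r%:E).
  by apply: emeasurable_funD => //; exact: measurable_cst.
rewrite foo addye// integralE.
have -> : \int[P]_x (fun x => f x + r%:E)^\+ x = +oo.
  apply/eqP; rewrite -leye_eq leNgt; apply/negP => fin.
  have : \int[P]_x f x <= \int[P]_x ((fun x => f x + r%:E)^\+ x + (- r)%:E).
    apply: ge0_le_integral => //.
    - apply: emeasurable_funD; last exact: measurable_cst.
      exact: measurable_funepos.
    - move=> x _; apply: (@le_trans _ _ (f x + r%:E + (- r)%:E)).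
        by rewrite EFinN addeK.
      by apply: leeD => //; rewrite funeposE le_max lexx.
  rewrite foo leye_eq ge0_integralD//.
  - by rewrite cstE; move: fin; case: (\int[P]_x (fun x0 : T => f x0 + r%:E)^\+ x).
  - exact: measurable_funepos.
  - by move=> x _; rewrite lee_fin oppr_ge0 ltW.
have : \int[P]_x (fun x => f x + r%:E)^\- x <= (- r)%:E.
  rewrite -(cstE (- r)%R); apply: ge0_le_integral => //.
  - exact: measurable_funeneg.
  - move=> x _; rewrite funenegE ge_max lee_fin oppr_ge0 (ltW r0) andbT.
    by rewrite EFinN leeN2 leeDr.
by case: (\int[P]_x _) => // s _; rewrite addye.
Qed.

Lemma geometric_sumE (R : realType) (a : R) n :
  ((1 - a) * \sum_(0 <= t < n) a ^+ t + a ^+ n = 1)%R.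
Proof.
elim: n => [|n IH]; first by rewrite big_nil expr0; ring.
by rewrite big_nat_recr//= -[RHS]IH exprS; ring.
Qed.

(** Summation by parts writes the discounted sum as a weighted mean of
    undiscounted partial sums. *)
Lemma discounted_sum_le (R : realType) (e : nat -> R) (C L a : R) N :
  (0 <= C)%R -> (0 <= a <= 1)%R ->
  (forall n, \sum_(0 <= t < n) e t <= C + n%:R * L)%R ->
  (\sum_(0 <= t < N) a ^+ t * e t <= C + L * \sum_(0 <= t < N) a ^+ t)%R.
Proof.
move=> C0 /andP[a0 a1] eC.
pose S n := (\sum_(0 <= t < n) e t - n%:R * L)%R.
have SC n : (S n <= C)%R by rewrite lerBlDr; exact: eC.
have id n : (\sum_(0 <= t < n) a ^+ t * e t - L * \sum_(0 <= t < n) a ^+ t =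
    (1 - a) * (\sum_(0 <= t < n) a ^+ t * S t.+1) + a ^+ n * S n)%R.
  elim: n => [|n IH]; first by rewrite !big_nil /S big_nil; ring.
  have SS : S n.+1 = (S n + e n - L)%R.
    by rewrite /S big_nat_recr//= -natr1; ring.
  rewrite !big_nat_recr//= SS exprS mulrDr opprD addrACA IH; ring.
rewrite -lerBlDr id.
apply: (@le_trans _ _ ((1 - a) * (\sum_(0 <= t < N) a ^+ t * C) + a ^+ N * C)%R).
  apply: lerD; last by rewrite ler_wpM2l// exprn_ge0.
  rewrite ler_wpM2l ?subr_ge0//; apply: ler_sum => t _.
  by rewrite ler_wpM2l// exprn_ge0.
by rewrite -mulr_suml mulrA -mulrDl geometric_sumE mul1r.
Qed.

Section costs.
Context (R : realType) (dX dA : measure_display) (X : measurableType dX)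
  (A : measurableType dA).
Local Notation W := (trajectory X A).
Variables (q : R.-pker (X * A) ~> X) (c : X * A -> \bar R) (K : R).
Hypotheses (mc : measurable_fun setT c) (cK : forall xa, K%:E <= c xa).

(** Being nonnegative, it can be summed and integrated in any order; each
    criterion then recovers its original value by adding a constant. *)
Definition excess_cost (xa : X * A) : \bar R := c xa - K%:E.
Local Notation c0 := excess_cost.

Lemma excess_cost_ge0 xa : 0 <= c0 xa.
Proof. by rewrite /c0 sube_ge0. Qed.

Lemma measurable_excess_cost : measurable_fun setT c0.
Proof. by apply: emeasurable_funB => //; exact: measurable_cst. Qed.

Lemma excess_costK xa : c0 xa + K%:E = c xa.
Proof. by rewrite /c0 subeK. Qed.

Definition stage_cost (pi : policy R X A) x t : \bar R :=
  \int[strategic_measure q pi x]_w c0 (state w t, action w t).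

Lemma stage_cost_ge0 pi x t : 0 <= stage_cost pi x t.
Proof. by apply: integral_ge0 => w _; exact: excess_cost_ge0. Qed.

Let mc0 t : measurable_fun setT (fun w : W => c0 (state w t, action w t)).
Proof.
exact: (measurableT_comp measurable_excess_cost (@measurable_state_action _ _ X A t)).
Qed.

Lemma v_finE pi x N :
  v_fin q c N 1 pi x = \sum_(0 <= t < N) stage_cost pi x t + (N%:R * K)%:E.
Proof.
rewrite /v_fin /stage_cost -ge0_integral_sum//; last first.
  by move=> t w _; exact: excess_cost_ge0.
rewrite -integral_shift; last 3 first.
- exact: probability_setT.
- by apply: emeasurable_sum => t; exact: mc0.
- by move=> w; apply: sume_ge0 => t _; exact: excess_cost_ge0.
apply: eq_integral => w _; elim: N => [|N IH].
  by rewrite !big_nil mul0r adde0.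
rewrite !big_nat_recr//= IH expr1n mul1e -excess_costK addeACA.
by rewrite -EFinD -natr1 mulrDl mul1r.
Qed.

Lemma v_discE a pi x : (0 <= a < 1)%R ->
  v_disc q c a pi x =
  \sum_(0 <= t <oo) (a ^+ t)%:E * stage_cost pi x t + (K / (1 - a))%:E.
Proof.
move=> /andP[a0 a1].
have at0 t : 0 <= (a ^+ t)%:E :> \bar R by rewrite lee_fin exprn_ge0.
have mat t : measurable_fun setT (fun w : W => (a ^+ t)%:E * c0 (state w t, action w t)).
  by apply: emeasurable_funM => //; exact: measurable_cst.
have at0c t (w : W) : 0 <= (a ^+ t)%:E * c0 (state w t, action w t).
  by rewrite mule_ge0//; exact: excess_cost_ge0.
rewrite /v_disc /stage_cost.
have -> : \sum_(0 <= t <oo) (a ^+ t)%:E *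
      \int[strategic_measure q pi x]_w c0 (state w t, action w t) =
    \sum_(0 <= t <oo) \int[strategic_measure q pi x]_w
      ((a ^+ t)%:E * c0 (state w t, action w t)).
  apply: eq_eseriesr => t _; rewrite ge0_integralZl//.
  by move=> w _; exact: excess_cost_ge0.
rewrite -integral_nneseries// -integral_shift; last 3 first.
- exact: probability_setT.
- by apply: ge0_emeasurable_sum => //.
- by move=> w; apply: nneseries_ge0.
apply: eq_integral => w _; apply/cvg_lim => //.
have -> : (fun n => \sum_(0 <= t < n) (a ^+ t)%:E * c (state w t, action w t)) =
    (fun n => \sum_(0 <= t < n) (a ^+ t)%:E * c0 (state w t, action w t) +
      (series (geometric K a) n)%:E).
  apply/funext; elim=> [|n IH]; first by rewrite !big_nil /series /= big_nil adde0.
  rewrite !big_nat_recr//= IH -excess_costK /series /= big_nat_recr//= EFinD.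
  by rewrite muleDr// ?fin_num_adde_defl// addeACA -EFinM [(a ^+ n * K)%R]mulrC.
apply: cvgeD; first by rewrite fin_num_adde_defl.
  by apply: is_cvg_nneseries => n _ _; exact: at0c.
apply: cvg_EFin; first exact: nearW.
by apply: cvg_geometric_series; rewrite ger0_norm.
Qed.

(** The upper limit controls the partial sums from some time on, and the
    constant [C] absorbs the earlier ones. *)
Lemma average_bound pi x (L : R) : w_avg q c pi x < L%:E ->
  exists C : R, [/\ (0 <= C)%R, (0 <= L - K)%R &
    forall n, \sum_(0 <= t < n) stage_cost pi x t <= (C + n%:R * (L - K))%:E].
Proof.
move=> /ereal_inf_lt[_ [V [N _ NV] <-] VL].
have vL n : (N <= n)%N -> n%:R^-1%:E * v_fin q c n 1 pi x <= L%:E.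
  move=> Nn; apply: le_trans (ltW VL); apply: ereal_sup_ubound.
  by exists n => //; exact: NV.
have SL n : (maxn N 1 <= n)%N -> \sum_(0 <= t < n) stage_cost pi x t <=
    (n%:R * (L - K))%:E.
  rewrite geq_max => /andP[Nn n0]; have := vL n Nn; rewrite v_finE.
  have n0' : (0 < n%:R :> R)%R by rewrite ltr0n.
  rewrite lee_pdivrMl// -leeBrDr// -EFinM -EFinB.
  by rewrite mulrBr.
pose M := maxn N 1.
have S0 n : 0 <= \sum_(0 <= t < n) stage_cost pi x t.
  by apply: sume_ge0 => t _; exact: stage_cost_ge0.
have [s sE] : exists s : R, \sum_(0 <= t < M) stage_cost pi x t = s%:E.
  have := SL M (leqnn _); have := S0 M.
  by case: (\sum_(0 <= t < M) _) => // s _ _; exists s.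
have s0 : (0 <= s)%R by have := S0 M; rewrite sE lee_fin.
have LK : (0 <= L - K)%R.
  have := le_trans (S0 M) (SL M (leqnn _)); rewrite lee_fin pmulr_rge0//.
  by rewrite ltr0n /M leq_max orbT.
exists s; split => // n; have [Mn|nM] := leqP M n.
  by apply: le_trans (SL n Mn) _; rewrite lee_fin lerDr.
apply: (@le_trans _ _ s%:E).
  rewrite -sE (big_cat_nat _ (ltnW nM))//= leeDl//.
  by apply: sume_ge0 => t _; exact: stage_cost_ge0.
by rewrite lee_fin lerDl mulr_ge0.
Qed.

Lemma discounted_bound pi x (L C a : R) : (0 <= C)%R -> (0 <= L - K)%R ->
  (0 <= a < 1)%R -> (forall n, \sum_(0 <= t < n) stage_cost pi x t <= (C + n%:R * (L - K))%:E) ->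
  v_disc q c a pi x <= (C + L / (1 - a))%:E.
Proof.
move=> C0 LK a01 hS; have /andP[a0 a1] := a01.
have /choice[e he] : forall t, exists r, stage_cost pi x t = r%:E.
  move=> t; have := hS t.+1; rewrite big_nat_recr//= => h.
  have : stage_cost pi x t <= (C + t.+1%:R * (L - K))%:E.
    apply: le_trans h; rewrite leeDr//.
    by apply: sume_ge0 => i _; exact: stage_cost_ge0.
  have := stage_cost_ge0 pi x t.
  by case: (stage_cost pi x t) => // s _ _; exists s.
have eC n : (\sum_(0 <= t < n) e t <= C + n%:R * (L - K))%R.
  rewrite -lee_fin -sumEFin; under eq_bigr do rewrite -he.
  exact: hS.
have e0 t : (0 <= e t)%R by rewrite -lee_fin -he stage_cost_ge0.
rewrite v_discE// -[leRHS](_ : (C + (L - K) / (1 - a))%:E + (K / (1 - a))%:E = _); last first.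
  by rewrite -EFinD; congr EFin; rewrite -addrA -mulrDl subrK.
rewrite leeD2r//; apply: lime_le.
  apply: is_cvg_nneseries => t _ _.
  by rewrite mule_ge0 ?stage_cost_ge0// lee_fin exprn_ge0.
near=> n; under eq_bigr do rewrite he -EFinM.
rewrite sumEFin lee_fin.
apply: le_trans (@discounted_sum_le _ e C (L - K) a n C0 _ eC) _.
  by rewrite a0 ltW.
rewrite lerD2l ler_wpM2l//.
rewrite -(@ler_pM2l _ (1 - a)%R) ?subr_gt0// divff ?subr_eq0 ?gt_eqF//.
by rewrite -[leRHS](geometric_sumE a n) lerDl exprn_ge0.
Unshelve. all: by end_near. Qed.

Lemma v_disc_ge pi x a : (0 <= a < 1)%R -> (K / (1 - a))%:E <= v_disc q c a pi x.
Proof.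
move=> a01; rewrite v_discE// leeDr//; apply: nneseries_ge0 => t _ _.
by rewrite mule_ge0 ?stage_cost_ge0// lee_fin exprn_ge0//; case/andP: a01.
Qed.

Lemma m_disc_ge a : (0 <= a < 1)%R -> (K / (1 - a))%:E <= m_disc q c a.
Proof.
move=> a01; apply/ereal_infP => _ [x _ <-]; apply/ereal_infP => _ [pi _ <-].
exact: v_disc_ge.
Qed.

Lemma m_disc_le pi x a : m_disc q c a <= v_disc q c a pi x.
Proof.
apply: (@le_trans _ _ (v_opt q c a x)); first by apply: ereal_inf_lbound; exists x.
by apply: ereal_inf_lbound; exists pi.
Qed.

Lemma m_disc_fin_num a : w_star q c < +oo -> (0 <= a < 1)%R ->
  m_disc q c a \is a fin_num.
Proof.
move=> /ereal_inf_lt[_ [x _ <-] /ereal_inf_lt[_ [pi _ <-] wfin]] a01.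
have [L wL] : exists L : R, w_avg q c pi x < L%:E.
  case: (w_avg q c pi x) wfin => [r| |] // _; last by exists 0%R; rewrite ltNye.
  by exists (r + 1)%R; rewrite lte_fin ltrDl.
have [C [C0 LK hS]] := average_bound wL.
rewrite fin_numE -ltNye -ltey; apply/andP; split.
  by apply: lt_le_trans (m_disc_ge a01); rewrite ltNye.
apply: le_lt_trans (m_disc_le pi x a) _.
by apply: le_lt_trans (discounted_bound C0 LK a01 hS) _; rewrite ltry.
Qed.

(** An inequality of Abelian type: the bound on partial sums in
    [average_bound] passes to the discounted sum by [discounted_bound], and
    after multiplication by [1 - a] the constant [C] disappears as [a] tends
    to 1. *)
Lemma w_bar_le_w_avg pi x : w_bar q c <= w_avg q c pi x.
Proof.
suff h (L : R) : w_avg q c pi x < L%:E -> w_bar q c <= L%:E.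
  move: h; case: (w_avg q c pi x) => [r| |] h; last 2 first.
  - by rewrite leey.
  - case E : (w_bar q c) => [s| |] //.
      by have := h (s - 1)%R (ltNyr _); rewrite E lee_fin lerDl oppr_ge0 ler10.
    by have := h 0%R (ltNyr _); rewrite E.
  apply/lee_addgt0Pr => e e0; rewrite -EFinD; apply: h.
  by rewrite lte_fin ltrDl.
move=> /average_bound[C [C0 LK hS]].
apply/lee_addgt0Pr => e e0; rewrite -EFinD.
apply: ge_ereal_inf.
exists (ereal_sup ((fun a : R => (1 - a)%:E * m_disc q c a) @`
    [set a : R | (0 <= a < 1)%R /\ ((1 - a) * C <= e)%R])).
  exists [set a : R | (0 <= a < 1)%R /\ ((1 - a) * C <= e)%R] => //.
  near=> a; split.
    by apply/andP; split; near: a; [exact: nbhs_left_ge|exact: nbhs_left_lt].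
  have : (1 - e / (C + 1) < a)%R.
    near: a; apply: nbhs_left_gt.
    by rewrite ltrBlDr ltrDl divr_gt0// ltr_wpDl.
  rewrite ltrBlDr -ltrBlDl ltr_pdivlMr ?ltr_wpDl// => /ltW.
  apply: le_trans; rewrite ler_wpM2l ?lerDl// subr_ge0.
  by near: a; exact: nbhs_left_le.
apply/ereal_supP => _ [a [a01 aC] <-].
have a1 : (0 < 1 - a)%R by rewrite subr_gt0; case/andP: a01.
apply: (@le_trans _ _ ((1 - a)%:E * (C + L / (1 - a))%:E)).
  rewrite lee_pmul2l//; apply: le_trans (m_disc_le pi x a) _.
  exact: discounted_bound.
rewrite -EFinM lee_fin mulrDr mulrCA divff ?gt_eqF// mulr1 addrC.
by rewrite lerD2l.
Unshelve. all: by end_near. Qed.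

Lemma w_bar_ge : K%:E <= w_bar q c.
Proof.
apply/ereal_infP => _ [V V1 <-].
have : \forall a \near (1%R : R)^'-, V a /\ (0 <= a < 1)%R.
  near=> a; split; first by near: a.
  by apply/andP; split; near: a; [exact: nbhs_left_ge|exact: nbhs_left_lt].
move=> /filter_ex[a [Va a01]].
apply: (@le_trans _ _ ((1 - a)%:E * m_disc q c a)); last first.
  by apply: ereal_sup_ubound; exists a.
have a1 : (0 < 1 - a)%R by rewrite subr_gt0; case/andP: a01.
apply: (@le_trans _ _ ((1 - a)%:E * (K / (1 - a))%:E)).
  by rewrite -EFinM lee_fin mulrCA divff ?gt_eqF// mulr1.
by rewrite lee_pmul2l//; exact: m_disc_ge.
Unshelve. all: by end_near. Qed.

Lemma w_bar_fin_num : w_star q c < +oo -> w_bar q c \is a fin_num.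
Proof.
move=> /ereal_inf_lt[_ [x _ <-] /ereal_inf_lt[_ [pi _ <-] wfin]].
rewrite fin_numE -ltNye -ltey; apply/andP; split.
  by apply: lt_le_trans w_bar_ge; rewrite ltNye.
exact: le_lt_trans (w_bar_le_w_avg pi x) wfin.
Qed.

Lemma near_w_bar (alpha : nat -> R) (r : R) : (forall n, (alpha n < 1)%R) ->
  alpha @ \oo --> (1%R : R) -> w_bar q c < r%:E ->
  \forall n \near \oo, (1 - alpha n)%:E * m_disc q c (alpha n) <= r%:E.
Proof.
move=> a1 acvg /ereal_inf_lt[_ [V V1 <-] Vr].
have {acvg}V1 := acvg _ V1.
near=> n; apply: le_trans (ltW Vr); apply: ereal_sup_ubound.
exists (alpha n) => //; have : (alpha n < 1)%R -> V (alpha n) by near: n.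
exact.
Unshelve. all: by end_near. Qed.

End costs.

(** * Lower semicontinuity under setwise continuity *)

Section lower_semicontinuity.
Context (R : realType) (T : topologicalType).

(** Lower semicontinuity. *)
Definition closed_sublevels (f : T -> \bar R) : Prop :=
  forall l : R, closed [set t | f t <= l%:E].

Lemma closed_sublevels_continuous (f : T -> \bar R) :
  continuous f -> closed_sublevels f.
Proof.
move=> cf l; apply: (closed_comp (f := f) (D := [set y | y <= l%:E])) => //.
exact: closed_ereal_ge_ereal.
Qed.

(** A sum exceeds [l] if and only if, for some real [s], one term exceeds [s]
    and the other [l - s]; infinite values cause no trouble as both terms are
    nonnegative. *)
Lemma closed_sublevelsD (f g : T -> \bar R) :
  (forall t, 0 <= f t) -> (forall t, 0 <= g t) ->
  closed_sublevels f -> closed_sublevels g ->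
  closed_sublevels (fun t => f t + g t).
Proof.
move=> f0 g0 cf cg l.
rewrite (_ : [set t | _] = \bigcap_(s in [set: R])
    ([set t | f t <= s%:E] `|` [set t | g t <= (l - s)%:E])).
  by apply: closed_bigI => s _; apply: closedU; [exact: cf|exact: cg].
apply/seteqP; split => [t /= fg s _|t h].
  have [|fs] := leP (f t) s%:E; [by left|right].
  rewrite /= EFinB leeBrDl//; apply: le_trans fg.
  by rewrite leeD2r// ltW.
rewrite /= leNgt; apply/negP => lfg.
have [s sf sg] : exists2 s : R, s%:E < f t & (l - s)%:E < g t.
  move: lfg (f0 t) (g0 t); case: (f t) => [a| |] //; case: (g t) => [b| |] // h' a0 b0.
  - move: h'; rewrite -EFinD lte_fin => h'.
    by exists (a - (a + b - l) / 2)%R; rewrite lte_fin; lra.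
  - by exists (a - 1)%R; rewrite ?ltry// lte_fin; lra.
  - by exists (l - b + 1)%R; rewrite ?ltry// lte_fin; lra.
  - by exists 0%R; rewrite ltry.
by have [|] := h s Logic.I; rewrite /= leNgt ?sf ?sg.
Qed.

Lemma closed_sublevelsZ (f : T -> \bar R) (r : R) : (0 <= r)%R ->
  closed_sublevels f -> closed_sublevels (fun t => r%:E * f t).
Proof.
rewrite le_eqVlt => /predU1P[<- _ l|r0 cf l].
  have [l0|l0] := leP 0%R l.
    rewrite (_ : [set t | _] = setT); first exact: closedT.
    by apply/seteqP; split => // t _ /=; rewrite mul0e lee_fin.
  rewrite (_ : [set t | _] = set0); first exact: closed0.
  by apply/seteqP; split => // t /=; rewrite mul0e lee_fin leNgt l0.
rewrite (_ : [set t | _] = [set t | f t <= (r^-1 * l)%:E]); first exact: cf.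
by apply/seteqP; split => t /=; rewrite EFinM lee_pdivlMl.
Qed.

Lemma closed_sublevels_sum (I : eqType) (s : seq I) (F : I -> T -> \bar R) :
  (forall i t, i \in s -> 0 <= F i t) -> (forall i, i \in s -> closed_sublevels (F i)) ->
  closed_sublevels (fun t => \sum_(i <- s) F i t).
Proof.
elim: s => [|i s IH] F0 cF.
  rewrite (_ : (fun t => _) = fun=> 0); last by apply/funext => t; rewrite big_nil.
  by apply: closed_sublevels_continuous => t; exact: cst_continuous.
rewrite (_ : (fun t => _) = fun t => F i t + \sum_(j <- s) F j t); last first.
  by apply/funext => t; rewrite big_cons.
apply: closed_sublevelsD => [t|t| |].
- by apply: F0; rewrite mem_head.
- by rewrite big_seq; apply: sume_ge0 => j js; apply: F0; rewrite in_cons js orbT.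
- by apply: cF; rewrite mem_head.
- by apply: IH => j; [move=> t|]; move=> js; [apply: F0|apply: cF];
    rewrite in_cons js orbT.
Qed.

Lemma closed_sublevels_sup (f : T -> \bar R) (F : nat -> T -> \bar R) :
  (forall n, closed_sublevels (F n)) ->
  (forall t, f t = ereal_sup (range (fun n => F n t))) -> closed_sublevels f.
Proof.
move=> cF fE l; rewrite (_ : [set t | _] = \bigcap_n [set t | F n t <= l%:E]).
  by apply: closed_bigI => n _; exact: cF.
apply/seteqP; split => t /=; rewrite fE.
  by move=> h n _; apply: le_trans h; apply: ereal_sup_ubound; exists n.
by move=> h; apply/ereal_supP => _ [n _ <-]; exact: h.
Qed.

Import HBNNSimple.

(** [V] is the supremum of simple functions, whose integrals are finite
    combinations, with nonnegative coefficients, of the continuous functions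
    [m t B]. *)
Lemma closed_sublevels_integral d (Y : measurableType d)
    (m : T -> {measure set Y -> \bar R}) (V : Y -> \bar R) :
  (forall B, measurable B -> continuous (fun t => m t B)) ->
  measurable_fun setT V -> (forall y, 0 <= V y) ->
  closed_sublevels (fun t => \int[m t]_y V y).
Proof.
move=> mcont mV V0.
pose V_ := nnsfun_approx measurableT mV.
apply: (@closed_sublevels_sup _ (fun n t => \int[m t]_y (V_ n y)%:E)) => [n|t].
  have -> : (fun t => \int[m t]_y (V_ n y)%:E) =
    (fun t => \sum_(r <- finmap.enum_fset (fset_set (range (V_ n)))) r%:E * m t (V_ n @^-1` [set r])).
    by apply/funext => t; rewrite integralT_nnsfun sintegralE fsbig_finite.
  have pos r : r \in finmap.enum_fset (fset_set (range (V_ n))) -> (0 <= r)%R.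
    have := in_fset_set (fimfunP (V_ n)) r => /= ->.
    by rewrite inE => -[y _ <-].
  apply: closed_sublevels_sum => [r t /pos r0|r /pos r0].
    by rewrite mule_ge0// lee_fin.
  apply: closed_sublevelsZ => //; apply: closed_sublevels_continuous.
  by apply: mcont.
have nd t' : {homo (fun n => \int[m t']_y (V_ n y)%:E) : i j / (i <= j)%N >-> i <= j}.
  move=> i j ij; apply: ge0_le_integral => //.
  - by move=> y _; rewrite lee_fin.
  - exact/measurable_EFinP.
  - exact/measurable_EFinP.
  - by move=> y _; rewrite lee_fin; exact/lefP/nd_nnsfun_approx.
have h1 := ereal_nondecreasing_cvgn (nd t).
have h2 : (fun n => \int[m t]_y (V_ n y)%:E) @ \oo --> \int[m t]_y V y.
  rewrite (_ : \int[m t]_y V y = \int[m t]_y limn (fun n => (V_ n y)%:E)).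
    apply: cvg_monotone_convergence => //.
    - by move=> n; exact/measurable_EFinP.
    - by move=> n y _; rewrite lee_fin.
    - by move=> y _ i j ij; rewrite lee_fin; exact/lefP/nd_nnsfun_approx.
  apply: eq_integral => y _; apply/esym/cvg_lim => //.
  exact: cvg_nnsfun_approx.
exact: cvg_unique h2 h1.
Qed.

Lemma inf_compactD (f g : T -> \bar R) : hausdorff_space T ->
  (forall t, 0 <= f t) -> (forall t, 0 <= g t) ->
  inf_compact f -> closed_sublevels g -> inf_compact (fun t => f t + g t).
Proof.
move=> hT f0 g0 cf cg l.
have cf' : closed_sublevels f by move=> s; exact: compact_closed.
apply: subclosed_compact (cf l) _; first exact: closed_sublevelsD.
by move=> t /=; apply: le_trans; rewrite leeDl.
Qed.

End lower_semicontinuity.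

(** * Value iteration for the discounted cost *)

Section value_iteration.
Context (R : realType) (SX SA : completePseudoMetricType R) (polishX : polish SX)
  (polishA : polish SA) (DX : set SX) (DA : set SA) (borelX : borel_set DX)
  (borelA : borel_set DA) (x0 : DX) (a0 : DA).

Local Notation X := (borel_sub x0).
Local Notation A := (borel_sub a0).
Local Notation W := (trajectory X A).

Variables (q : R.-pker (X * A)%type ~> X) (g : X * A -> \bar R).
Hypotheses (mg : measurable_fun setT g) (g_ge0 : forall xa, 0 <= g xa)
  (g_inf_compact : forall x, inf_compact (fun a => g (x, a)))
  (q_setwise : forall (x : X) (B : set X), measurable B ->
    continuous (fun a : A => q (x, a) B)).

(** A discount factor is put into [V], so that varying factors and varying
    functions go to the limit together. *)
Definition cost_to_go (V : X -> \bar R) (xa : X * A) : \bar R :=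
  g xa + \int[q xa]_y V y.

Lemma cost_to_go_ge0 V : (forall y, 0 <= V y) -> forall xa, 0 <= cost_to_go V xa.
Proof. by move=> V0 xa; rewrite adde_ge0//; apply: integral_ge0. Qed.

Lemma measurable_integral_kernel (V : X -> \bar R) : (forall y, 0 <= V y) ->
  measurable_fun setT V -> measurable_fun setT (fun xa => \int[q xa]_y V y).
Proof.
move=> V0 mV; apply: measurable_fun_integral_kernel => // B mB.
exact: measurable_kernel.
Qed.

Lemma measurable_cost_to_go V : (forall y, 0 <= V y) -> measurable_fun setT V ->
  measurable_fun setT (cost_to_go V).
Proof.
by move=> V0 mV; apply: emeasurable_funD => //; exact: measurable_integral_kernel.
Qed.

Lemma inf_compact_cost_to_go V : (forall y, 0 <= V y) -> measurable_fun setT V ->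
  forall x, inf_compact (fun a => cost_to_go V (x, a)).
Proof.
move=> V0 mV x; apply: inf_compactD.
- by apply: borel_sub_hausdorff; case: polishA.
- by move=> a; exact: g_ge0.
- by move=> a; apply: integral_ge0.
- exact: g_inf_compact.
- by apply: closed_sublevels_integral => // B mB; exact: q_setwise.
Qed.

Lemma le_cost_to_go V V' : measurable_fun setT V -> measurable_fun setT V' ->
  (forall y, 0 <= V y) -> (forall y, V y <= V' y) ->
  forall xa, cost_to_go V xa <= cost_to_go V' xa.
Proof.
move=> mV mV' V0 VV' xa; rewrite leeD2l//; apply: ge0_le_integral => //.
Qed.

Lemma cost_to_go_selector V : (forall y, 0 <= V y) -> measurable_fun setT V ->
  exists phi : X -> A, [/\ measurable_fun setT phi,
    measurable_fun setT (fun x => cost_to_go V (x, phi x)) &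
    forall x a, cost_to_go V (x, phi x) <= cost_to_go V (x, a)].
Proof.
move=> V0 mV; apply: (measurable_minimiser polishX polishA borelX borelA).
- exact: measurable_cost_to_go.
- exact: cost_to_go_ge0.
- exact: inf_compact_cost_to_go.
Qed.

(** Compactness produces one action that is good for all [n]; for this action,
    monotone convergence gives the limit. *)
Lemma cost_to_go_limit (V_ : nat -> X -> \bar R) (V : X -> \bar R) (l : nat -> R)
    (L : R) x :
  (forall n y, 0 <= V_ n y) -> (forall n, measurable_fun setT (V_ n)) ->
  (forall y, {homo V_ ^~ y : m n / (m <= n)%N >-> m <= n}) ->
  (forall y, V_ ^~ y @ \oo --> V y) ->
  (forall m n, (m <= n)%N -> (l n <= l m)%R) -> l @ \oo --> L ->
  (forall n, exists a, cost_to_go (V_ n) (x, a) <= (l n)%:E) ->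
  exists a, cost_to_go V (x, a) <= L%:E.
Proof.
move=> V0 mV ndV cvV nil cvl hl.
have [||//|//|a ha] := @inf_compact_common_point _ _ polishA _ a0
    (fun n a => cost_to_go (V_ n) (x, a)) l.
- by move=> n; exact: inf_compact_cost_to_go.
- by move=> m n a mn; apply: le_cost_to_go => // y; exact: ndV.
exists a.
have cvI : \int[q (x, a)]_y V_ n y @[n --> \oo] --> \int[q (x, a)]_y V y.
  rewrite (_ : \int[q (x, a)]_y V y = \int[q (x, a)]_y limn (V_ ^~ y)).
    by apply: cvg_monotone_convergence => // y _; exact: ndV.
  by apply: eq_integral => y _; apply/esym/cvg_lim => //; exact: cvV.
have I0 : 0 <= \int[q (x, a)]_y V y.
  apply: integral_ge0 => y _; rewrite -(cvg_lim _ (cvV y))//.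
  by apply: lime_ge; [apply/cvg_ex; exists (V y)|exact: nearW].
have cvQ : cost_to_go (V_ n) (x, a) @[n --> \oo] --> cost_to_go V (x, a).
  by apply: cvgeD => //; [apply: ge0_adde_def; rewrite inE|exact: cvg_cst].
have cvL : (l n)%:E @[n --> \oo] --> L%:E by apply: cvg_EFin => //; exact: nearW.
exact: (lee_cvg_to cvQ cvL (nearW _ ha)).
Qed.

Variable b : R.
Hypothesis b01 : (0 <= b < 1)%R.

Let b0 : 0 <= b%:E :> \bar R.
Proof. by rewrite lee_fin; case/andP: b01. Qed.

Let bn0 n : 0 <= (b ^+ n)%:E :> \bar R.
Proof. by rewrite lee_fin exprn_ge0//; case/andP: b01. Qed.

Fixpoint value_iterate (n : nat) (x : X) : \bar R :=
  if n is n'.+1 then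
    ereal_inf (range (fun a => cost_to_go (fun y => b%:E * value_iterate n' y) (x, a)))
  else 0.

(** The limit of value iteration started at 0. *)
Definition value (x : X) : \bar R := ereal_sup (range (fun n => value_iterate n x)).

Lemma value_iterate_ge0 n x : 0 <= value_iterate n x.
Proof.
elim: n x => [//|n IH] x; apply/ereal_infP => _ [a _ <-].
by apply: cost_to_go_ge0 => y; rewrite mule_ge0.
Qed.

Let bV0 n y : 0 <= b%:E * value_iterate n y.
Proof. by rewrite mule_ge0// value_iterate_ge0. Qed.

Let mZ V : measurable_fun setT V -> measurable_fun setT (fun y : X => b%:E * V y).
Proof. by move=> mV; apply: emeasurable_funM => //; exact: measurable_cst. Qed.

Lemma measurable_value_iterate n : measurable_fun setT (value_iterate n).
Proof.
elim: n => [|n IH]; first exact: measurable_cst.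
have [phi [_ mQ le]] := cost_to_go_selector (bV0 n) (mZ IH).
rewrite (_ : value_iterate _ = (fun x => cost_to_go (fun y => b%:E * value_iterate n y) (x, phi x)))//.
apply/funext => x; apply/eqP; rewrite eq_le; apply/andP; split.
  by apply: ereal_inf_lbound; exists (phi x).
by apply/ereal_infP => _ [a _ <-]; exact: le.
Qed.

Lemma value_iterate_le_cost n x a :
  value_iterate n.+1 x <= g (x, a) + b%:E * \int[q (x, a)]_y value_iterate n y.
Proof.
rewrite -ge0_integralZl//; last 2 first.
- exact: measurable_value_iterate.
- by move=> y _; exact: value_iterate_ge0.
by apply: ereal_inf_lbound; exists a.
Qed.

Lemma value_iterateS n x : value_iterate n x <= value_iterate n.+1 x.
Proof.
elim: n x => [|n IH] x; first exact: value_iterate_ge0.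
apply/ereal_infP => _ [a _ <-].
apply: (@le_trans _ _ (cost_to_go (fun y => b%:E * value_iterate n y) (x, a))).
  by apply: ereal_inf_lbound; exists a.
apply: le_cost_to_go => //.
- exact: (mZ (measurable_value_iterate n)).
- exact: (mZ (measurable_value_iterate n.+1)).
- by move=> y; rewrite lee_wpmul2l.
Qed.

Lemma nondecreasing_value_iterate x :
  {homo value_iterate ^~ x : m n / (m <= n)%N >-> m <= n}.
Proof. by apply/nondecreasing_seqP => n; exact: value_iterateS. Qed.

Lemma cvg_value x : value_iterate ^~ x @ \oo --> value x.
Proof. by apply: ereal_nondecreasing_cvgn; exact: nondecreasing_value_iterate. Qed.

Lemma measurable_value : measurable_fun setT value.
Proof.
apply: (emeasurable_fun_cvg value_iterate) => [n|x _]; last exact: cvg_value.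
exact: measurable_value_iterate.
Qed.

Lemma value_ge0 x : 0 <= value x.
Proof. by apply: ereal_sup_ubound; exists 0%N. Qed.

(** The minimal cost to go with [value_iterate n] as continuation is at most
    [value x] for all [n], so [cost_to_go_limit] at a constant level shows
    that the minimal cost to go with [value] as continuation is at most [value
    x]. *)
Lemma value_selector : exists2 phi : X -> A, measurable_fun setT phi &
  forall x, g (x, phi x) + b%:E * \int[q (x, phi x)]_y value y <= value x.
Proof.
have bV y : 0 <= b%:E * value y by rewrite mule_ge0// value_ge0.
have [phi [mphi _ le]] := cost_to_go_selector bV (mZ measurable_value).
exists phi => // x; rewrite -ge0_integralZl//; last 2 first.
- exact: measurable_value.
- by move=> y _; exact: value_ge0.
rewrite -/(cost_to_go _ _).
have [voo|] := eqVneq (value x) +oo; first by rewrite voo leey.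
move=> vfin; have [r rE] : exists r : R, value x = r%:E.
  by move: (value_ge0 x) vfin; case: (value x) => // s _ _; exists s.
rewrite rE.
have [|||||||a ha] := @cost_to_go_limit (fun n y => b%:E * value_iterate n y)
    (fun y => b%:E * value y) (fun=> r) r x.
- exact: bV0.
- by move=> n; exact: (mZ (measurable_value_iterate n)).
- by move=> y m n mn; rewrite lee_wpmul2l//; exact: nondecreasing_value_iterate.
- by move=> y; apply: cvgeZl => //; exact: cvg_value.
- by [].
- exact: cvg_cst.
- move=> n; have [psi [_ _ lepsi]] :=
    cost_to_go_selector (bV0 n) (mZ (measurable_value_iterate n)).
  exists (psi x); rewrite -rE.
  apply: (@le_trans _ _ (value_iterate n.+1 x)).
    by apply/ereal_infP => _ [a _ <-]; exact: lepsi.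
  by apply: ereal_sup_ubound; exists n.+1.
exact: le_trans (le x a) ha.
Qed.

Section policies.
Variables (pi : policy R X A) (x : X).
Local Notation P := (strategic_measure q pi x).
Local Notation stage t := (\int[P]_w g (state w t, action w t)).

Let stage_ge0 t : 0 <= stage t.
Proof. by apply: integral_ge0. Qed.

Let mgt t : measurable_fun setT (fun w : W => g (state w t, action w t)).
Proof. exact: (measurableT_comp mg (@measurable_state_action _ _ X A t)). Qed.

(** The iterates bound from below the cost of every policy, even history
    dependent: their defining inequality holds for each action, and so for the
    one that is drawn. *)
Lemma integral_value_iterate_le n t :
  \int[P]_w value_iterate n (state w t) <=
  \sum_(0 <= s < n) (b ^+ s)%:E * stage (t + s)%N.
Proof.
elim: n t => [|n IH] t.
  by rewrite big_nil; under eq_integral do rewrite /=; rewrite integral0.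
have mV := measurable_value_iterate n.
have mI : measurable_fun setT (fun w : W => \int[q (state w t, action w t)]_y value_iterate n y).
  by apply: (measurableT_comp (measurable_integral_kernel (value_iterate_ge0 n) mV));
    exact: measurable_state_action.
have I0 (w : W) : 0 <= \int[q (state w t, action w t)]_y value_iterate n y.
  by apply: integral_ge0 => y _; exact: value_iterate_ge0.
apply: (@le_trans _ _ (\int[P]_w (g (state w t, action w t) +
    b%:E * \int[q (state w t, action w t)]_y value_iterate n y))).
  apply: ge0_le_integral => //.
  - by move=> w _; exact: value_iterate_ge0.
  - apply: (measurableT_comp (measurable_value_iterate n.+1)).
    exact: measurable_state.
  - apply: emeasurable_funD => //.
    by apply: emeasurable_funM => //; exact: measurable_cst.
  - by move=> w _; exact: value_iterate_le_cost.
rewrite ge0_integralD//; last 2 first.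
- by move=> w _; rewrite mule_ge0.
- by apply: emeasurable_funM => //; exact: measurable_cst.
rewrite ge0_integralZl// -integral_next_state//; last exact: value_iterate_ge0.
rewrite big_nat_recl// expr0 mul1e addn0 leeD2l//.
apply: (@le_trans _ _ (b%:E * (\sum_(0 <= s < n) (b ^+ s)%:E * stage (t.+1 + s)%N))).
  by rewrite lee_wpmul2l.
rewrite ge0_sume_distrr; last by move=> s _; rewrite mule_ge0.
apply: lee_sum => s _.
by rewrite addSnnS muleA -EFinM -exprS.
Qed.

Lemma value_le : value x <= \sum_(0 <= t <oo) (b ^+ t)%:E * stage t.
Proof.
apply/ereal_supP => _ [n _ <-].
have := integral_value_iterate_le n 0.
rewrite integral_state0; last 2 first.
- exact: value_iterate_ge0.
- exact: measurable_value_iterate.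
move=> h; apply: le_trans h _.
by apply: nneseries_lim_ge => t _ _; rewrite mule_ge0.
Qed.

End policies.

Section deterministic_policies.
Variables (phi : {mfun X >-> A}) (x : X).
Local Notation P := (strategic_measure q (deterministic_policy R phi) x).
Local Notation stage t := (\int[P]_w g (state w t, action w t)).

(** A pointwise inequality of the type of Bellman, integrated along the
    trajectory of a deterministic policy. Its two uses are the discounted
    inequality, with [s] zero, and the average-cost one, with [r] one. *)
Lemma integral_stage_deterministic_le (V : X -> \bar R) (r : R) (s : R) t :
  (0 <= r)%R -> (0 <= s)%R ->
  (forall y, 0 <= V y) -> measurable_fun setT V ->
  (forall y, g (y, phi y) + r%:E * \int[q (y, phi y)]_z V z <= V y + s%:E) ->
  stage t + r%:E * \int[P]_w V (state w t.+1) <= \int[P]_w V (state w t) + s%:E.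
Proof.
move=> r0 s0 V0 mV hV.
have mI : measurable_fun setT (fun xa => \int[q xa]_y V y).
  exact: measurable_integral_kernel.
have I0 xa : 0 <= \int[q xa]_y V y by apply: integral_ge0.
have mS := @measurable_state _ _ X A t.
have mp : measurable_fun setT (fun w : W => (state w t, phi (state w t))).
  by apply: measurable_fun_pair => //; apply: measurableT_comp.
rewrite integral_next_state// integral_deterministic//.
rewrite (integral_deterministic q phi x t I0 mI).
rewrite -ge0_integralZl//; last exact: (measurableT_comp mI mp).
rewrite -ge0_integralD//; last 3 first.
- exact: (measurableT_comp mg mp).
- by move=> w _; rewrite mule_ge0.
- apply: emeasurable_funM; first exact: measurable_cst.
  exact: (measurableT_comp mI mp).
rewrite -(integral_shift _ (probability_setT P) (measurableT_comp mV mS)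
  (fun w => V0 (state w t))).
apply: ge0_le_integral => //.
- by move=> w _; rewrite adde_ge0// mule_ge0.
- apply: emeasurable_funD; first exact: (measurableT_comp mg mp).
  apply: emeasurable_funM; first exact: measurable_cst.
  exact: (measurableT_comp mI mp).
- by apply: emeasurable_funD => //; exact: (measurableT_comp mV mS).
Qed.

(** By iteration, the discounted cost of the first [n] stages plus the
    discounted value of the [n]-th state is at most [value x]. *)
Lemma value_ge_deterministic :
  (forall y, g (y, phi y) + b%:E * \int[q (y, phi y)]_z value z <= value y) ->
  \sum_(0 <= t <oo) (b ^+ t)%:E * stage t <= value x.
Proof.
move=> hphi.
have st0 t : 0 <= stage t by apply: integral_ge0.
have h n : \sum_(0 <= t < n) (b ^+ t)%:E * stage t +
    (b ^+ n)%:E * \int[P]_w value (state w n) <= value x.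
  elim: n => [|n IH].
    rewrite big_nil expr0 mul1e add0e integral_state0//; first exact: value_ge0.
    exact: measurable_value.
  apply: le_trans IH; rewrite big_nat_recr//= -addeA leeD2l//.
  rewrite exprSr EFinM -muleA -ge0_muleDr//; last first.
    by rewrite mule_ge0//; apply: integral_ge0 => w _; exact: value_ge0.
  rewrite lee_wpmul2l// -[leRHS]adde0.
  apply: integral_stage_deterministic_le => //.
  - exact: value_ge0.
  - exact: measurable_value.
  - by move=> y; rewrite adde0.
apply: lime_le.
  by apply: is_cvg_nneseries => t _ _; rewrite mule_ge0.
apply: nearW => n; apply: le_trans (h n).
by rewrite leeDl// mule_ge0//; apply: integral_ge0 => w _; exact: value_ge0.
Qed.

End deterministic_policies.

End value_iteration.

(** * The optimality inequality *)

Section optimality.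
Context (R : realType) (SX SA : completePseudoMetricType R) (polishX : polish SX)
  (polishA : polish SA) (DX : set SX) (DA : set SA) (borelX : borel_set DX)
  (borelA : borel_set DA) (x0 : DX) (a0 : DA).

Local Notation X := (borel_sub x0).
Local Notation A := (borel_sub a0).

Variables (q : R.-pker (X * A)%type ~> X) (c : X * A -> \bar R) (K : R).
Hypotheses (mc : measurable_fun setT c) (cK : forall xa, K%:E <= c xa)
  (c_inf_compact : forall x, inf_compact (fun a => c (x, a)))
  (q_setwise : forall (x : X) (B : set X), measurable B ->
    continuous (fun a : A => q (x, a) B)).

Local Notation c0 := (excess_cost c K).

Let mc0 : measurable_fun setT c0.
Proof. exact: measurable_excess_cost. Qed.

Let c0_ge0 xa : 0 <= c0 xa.
Proof. exact: excess_cost_ge0. Qed.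

Lemma inf_compact_excess_cost x : inf_compact (fun a => c0 (x, a)).
Proof.
move=> l; rewrite (_ : [set a | _] = [set a | c (x, a) <= (l + K)%:E]).
  exact: c_inf_compact.
by apply/seteqP; split => a /=; rewrite /excess_cost leeBlDr.
Qed.

Local Notation val := (value q c0).

Lemma v_optE b x : (0 <= b < 1)%R ->
  v_opt q c b x = val b x + (K / (1 - b))%:E.
Proof.
move=> b01; apply/eqP; rewrite eq_le; apply/andP; split.
  have [phi mphi hphi] := value_selector polishX polishA borelX borelA mc0 c0_ge0
    inf_compact_excess_cost q_setwise b01.
  pose f : {mfun X >-> A} := HB.pack_for {mfun X >-> A} phi
    (isMeasurableFun.Build _ _ _ _ phi mphi).
  apply: (@le_trans _ _ (v_disc q c b (deterministic_policy R f) x)).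
    by apply: ereal_inf_lbound; exists (deterministic_policy R f).
  rewrite (v_discE q mc cK)// leeD2r//.
  exact: (value_ge_deterministic (phi := f) polishX polishA borelX borelA mc0 c0_ge0
    inf_compact_excess_cost q_setwise b01 x hphi).
apply/ereal_infP => _ [pi _ <-]; rewrite (v_discE q mc cK)// leeD2r//.
exact: (value_le polishX polishA borelX borelA mc0 c0_ge0
    inf_compact_excess_cost q_setwise b01).
Qed.

Hypothesis w_star_finite : w_star q c < +oo.

Section relative_value.
Variable b : R.
Hypothesis b01 : (0 <= b < 1)%R.

Lemma u_disc_ge0 x : 0 <= u_disc q c b x.
Proof.
rewrite /u_disc sube_ge0; last by rewrite (m_disc_fin_num mc cK).
by apply: ereal_inf_lbound; exists x.
Qed.

Lemma value_relative x :
  val b x = u_disc q c b x + (fine (m_disc q c b) - K / (1 - b))%:E.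
Proof.
have mfin := m_disc_fin_num mc cK w_star_finite b01.
rewrite /u_disc v_optE// -[X in _ - X]fineK// -EFinN -!addeA -!EFinD.
by rewrite addKr subrr adde0.
Qed.

Lemma measurable_u_disc : measurable_fun setT (u_disc q c b).
Proof.
rewrite (_ : u_disc q c b = fun x => val b x - (fine (m_disc q c b) - K / (1 - b))%:E).
  apply: emeasurable_funB; last exact: measurable_cst.
  exact: (measurable_value polishX polishA borelX borelA mc0 c0_ge0
    inf_compact_excess_cost q_setwise b01).
by apply/funext => x; rewrite value_relative addeK.
Qed.

(** The inequality of [value_selector] with a constant subtracted from
    [value]: as [q] is a probability the integral loses the same constant,
    multiplied by [b], whence the factor [1 - b]. *)
Lemma discounted_inequality x : exists a,
  c0 (x, a) + b%:E * \int[q (x, a)]_y u_disc q c b y <=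
  u_disc q c b x + ((1 - b) * fine (m_disc q c b) - K)%:E.
Proof.
have [phi _ hphi] := value_selector polishX polishA borelX borelA mc0 c0_ge0
    inf_compact_excess_cost q_setwise b01.
exists (phi x); have := hphi x; rewrite value_relative.
under eq_integral do rewrite value_relative.
rewrite integral_shift; last 3 first.
- exact: prob_kernel.
- exact: measurable_u_disc.
- exact: u_disc_ge0.
have b1 : (1 - b != 0)%R by rewrite subr_eq0 gt_eqF//; case/andP: b01.
set m := (fine _ - _)%R.
have -> : ((1 - b) * fine (m_disc q c b) - K = m - b * m)%R.
  by rewrite /m; field.
move=> h; rewrite EFinB addeA leeBrDr//; apply: le_trans h.
rewrite (@muleDr _ _ (\int[q (x, phi x)]_y u_disc q c b y) m%:E)//.
  by rewrite addeA -EFinM.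
exact: fin_num_adde_defl.
Qed.

End relative_value.

Variable alpha : nat -> R.
Hypotheses (alpha_range : forall n, (0 <= alpha n < 1)%R)
  (alpha_nondecreasing : forall i j, (i <= j)%N -> (alpha i <= alpha j)%R)
  (alpha_cvg : alpha @ \oo --> (1%R : R))
  (u_finite : forall x, u_lim q c alpha x < +oo).

Local Notation u := (u_lim q c alpha).

(** Nonnegative functions that increase to [u], so that monotone convergence
    applies to them. *)
Let U n x := einfs (fun k => u_disc q c (alpha k) x) n.

Let U_ge0 n x : 0 <= U n x.
Proof. by apply/ereal_infP => _ [k _ <-]; exact: u_disc_ge0. Qed.

Let mU n : measurable_fun setT (U n).
Proof. by apply: measurable_fun_einfs => k; exact: measurable_u_disc. Qed.

Let ndU x : {homo U ^~ x : m n / (m <= n)%N >-> m <= n}.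
Proof. exact: nondecreasing_einfs. Qed.

Let cvU x : U ^~ x @ \oo --> u x.
Proof. by rewrite /u_lim limn_einf_lim; exact: is_cvg_einfs. Qed.

Let U_le n x : U n x <= u x.
Proof.
rewrite /u_lim limn_einf_lim (cvg_lim _ (@cvg_einfs_sup _ _))//.
by apply: ereal_sup_ubound; exists n.
Qed.

Lemma u_lim_ge0 x : 0 <= u x.
Proof. exact: le_trans (U_ge0 0 x) (U_le 0 x). Qed.

Lemma measurable_u_lim : measurable_fun setT u.
Proof. by apply: (emeasurable_fun_cvg U) => // x _; exact: cvU. Qed.

Let u_fin x : u x \is a fin_num.
Proof. by rewrite ge0_fin_numE// u_lim_ge0. Qed.

Let wfin : w_bar q c \is a fin_num.
Proof. exact: w_bar_fin_num. Qed.

(** The discounted inequality cannot be passed to the lower limit directly, as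
    the action and the subsequence depend on [n]. But since [U n] and [alpha
    n] are below [u_disc (alpha k)] and [alpha k] for [k >= n], each [n] has
    an action whose cost to go for [alpha n] and [U n] is almost as small as
    wanted, and [cost_to_go_limit] extracts a single action from these. *)
Lemma u_lim_inequality x : exists a,
  cost_to_go q c0 u (x, a) <= (fine (w_bar q c) - K + fine (u x))%:E.
Proof.
set r := fine (w_bar q c); set s := fine (u x).
apply: (cost_to_go_limit polishA c0_ge0 inf_compact_excess_cost q_setwise
  (V_ := fun n y => (alpha n)%:E * U n y)
  (* One mesh is lost in approximating u x, and one in approximating w_bar. *)
  (l := fun n => (r - K + s + 2 * mesh R n)%R)).
- by move=> n y; rewrite mule_ge0// lee_fin; case/andP: (alpha_range n).
- by move=> n; apply: emeasurable_funM => //; exact: measurable_cst.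
- move=> y m n mn; apply: lee_pmul => //.
  + by rewrite lee_fin; case/andP: (alpha_range m).
  + by rewrite lee_fin alpha_nondecreasing.
  + exact: ndU.
- move=> y; rewrite -[X in _ --> X]mul1e; apply: cvgeM => //.
  + exact: mule_def_fin.
  + by apply: cvg_EFin => //; exact: nearW.
- by move=> m n mn; rewrite lerD2l ler_pM2l//; exact: mesh_le.
- rewrite [X in _ --> X](_ : (r - K + s)%R = (r - K + s + 2 * 0)%R); last first.
    by rewrite mulr0 addr0.
  by apply: cvgD; [exact: cvg_cst|apply: cvgM; [exact: cvg_cst|exact: cvg_harmonic]].
move=> n; have e0 := mesh_gt0 R n; set e := mesh R n in e0 *.
have [||N _ hN] := @near_w_bar _ _ _ _ _ q c alpha (r + e)%R _ alpha_cvg.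
- by move=> k; case/andP: (alpha_range k).
- by rewrite -[w_bar q c]fineK// lte_fin ltrDl.
have : U (maxn n N) x < (s + e)%:E.
  by apply: le_lt_trans (U_le _ _) _; rewrite -[u x]fineK// lte_fin ltrDl.
move=> /ereal_inf_lt[_ [k /= nk <-] uk].
move: nk; rewrite geq_max => /andP[nk Nk].
have [a ha] := discounted_inequality (alpha_range k) x.
exists a; apply: le_trans (le_trans ha _); last first.
  rewrite (_ : r - K + s + 2 * e = (s + e) + (r + e - K))%R; last by ring.
  rewrite [leRHS]EFinD; apply: leeD; first exact: ltW.
  have := hN k Nk; rewrite /= -[m_disc q c _]fineK; last exact: (m_disc_fin_num mc cK).
  by rewrite -EFinM !lee_fin lerD2r.
rewrite leeD2l// -ge0_integralZl//; last 3 first.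
- exact: measurable_u_disc.
- by move=> y _; exact: u_disc_ge0.
- by rewrite lee_fin; case/andP: (alpha_range k).
apply: ge0_le_integral => //.
- by move=> y _; rewrite mule_ge0// lee_fin; case/andP: (alpha_range n).
- by apply: emeasurable_funM => //; exact: measurable_cst.
- apply: emeasurable_funM; first exact: measurable_cst.
  exact: measurable_u_disc.
move=> y _; apply: lee_pmul => //.
- by rewrite lee_fin; case/andP: (alpha_range n).
- by rewrite lee_fin alpha_nondecreasing.
- by apply: ereal_inf_lbound; exists k.
Qed.

Lemma optimality_inequality : exists phi : {mfun X >-> A}, forall x,
  c0 (x, phi x) + \int[q (x, phi x)]_y u y <=
  u x + (fine (w_bar q c) - K)%:E.
Proof.
have [phi [mphi _ le]] := cost_to_go_selector polishX polishA borelX borelA mc0 c0_ge0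
    inf_compact_excess_cost q_setwise u_lim_ge0 measurable_u_lim.
exists (HB.pack_for {mfun X >-> A} phi (isMeasurableFun.Build _ _ _ _ phi mphi)) => x.
have [a ha] := u_lim_inequality x.
apply: le_trans (le x a) (le_trans ha _).
by rewrite EFinD addeC fineK.
Qed.

(** Iterated along the trajectory, the inequality bounds the cost of [N]
    stages by [u x + N * w_bar], so the average cost is at most [w_bar], which
    by [w_bar_le_w_avg] is a lower bound for all policies. *)
Lemma optimality_inequality_average (phi : {mfun X >-> A}) :
  (forall x, c0 (x, phi x) + \int[q (x, phi x)]_y u y <=
    u x + (fine (w_bar q c) - K)%:E) ->
  average_cost_optimal q c (deterministic_policy R phi).
Proof.
move=> hphi x; set pi := deterministic_policy R phi.
set r := fine (w_bar q c) in hphi *; set s := fine (u x).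
have rK : (0 <= r - K)%R.
  by rewrite subr_ge0 -lee_fin fineK//; exact: w_bar_ge.
have u0 := u_lim_ge0.
have mu := measurable_u_lim.
have bound n : \sum_(0 <= t < n) stage_cost q c K pi x t +
    \int[strategic_measure q pi x]_w u (state w n) <= (s + n%:R * (r - K))%:E.
  elim: n => [|n IH].
    by rewrite big_nil add0e integral_state0// mul0r addr0 fineK.
  rewrite big_nat_recr//= -addeA.
  apply: (@le_trans _ _ (\sum_(0 <= t < n) stage_cost q c K pi x t +
      (\int[strategic_measure q pi x]_w u (state w n) + (r - K)%:E))).
    rewrite leeD2l// -[X in _ + X]mul1e.
    apply: (integral_stage_deterministic_le mc0 c0_ge0) => // y.
    by rewrite mul1e.
  rewrite (_ : s + n.+1%:R * (r - K) = (s + n%:R * (r - K)) + (r - K))%R.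
    by rewrite addeA [leRHS]EFinD leeD2r.
  by rewrite -natr1 mulrDl mul1r addrA.
have vle n : v_fin q c n 1 pi x <= (s + n%:R * r)%:E.
  rewrite (v_finE q mc cK).
  apply: (@le_trans _ _ ((s + n%:R * (r - K))%:E + (n%:R * K)%:E)).
    rewrite leeD2r//; apply: le_trans (bound n).
    by rewrite leeDl//; apply: integral_ge0.
  by rewrite -EFinD lee_fin -addrA -mulrDr subrK.
apply/eqP; rewrite eq_le; apply/andP; split; last first.
  by apply: ereal_inf_lbound; exists pi.
apply: (@le_trans _ _ (w_bar q c)); last first.
  by apply/ereal_infP => _ [pi' _ <-]; exact: w_bar_le_w_avg.
have s0 : (0 <= s)%R by rewrite -lee_fin fineK.
rewrite -[w_bar q c]fineK//; apply/lee_addgt0Pr => e e0.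
apply: ge_ereal_inf.
exists (ereal_sup ((fun n => n%:R^-1%:E * v_fin q c n 1 pi x) @`
    [set n : nat | (0 < n)%N /\ (s / e <= n%:R)%R])).
  exists [set n : nat | (0 < n)%N /\ (s / e <= n%:R)%R] => //.
  near=> n; split; first by near: n; exact: nbhs_infty_gt.
  by near: n; exact: nbhs_infty_ger.
apply/ereal_supP => _ [n [n0 sn] <-].
have n0' : (0 < n%:R :> R)%R by rewrite ltr0n.
rewrite lee_pdivrMl//; apply: le_trans (vle n) _.
rewrite -EFinD -EFinM lee_fin mulrDr addrC lerD2l.
by move: sn; rewrite ler_pdivrMr.
Unshelve. all: by end_near. Qed.

End optimality.

Theorem theorem3p3 (R : realType)
    (SX SA : completePseudoMetricType R) (polishX : polish SX)
    (polishA : polish SA)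
    (DX : set SX) (DA : set SA) (borelX : borel_set DX) (borelA : borel_set DA)
    (x0 : DX) (a0 : DA)
    (q : R.-pker (borel_sub x0 * borel_sub a0)%type ~> borel_sub x0)
    (c : borel_sub x0 * borel_sub a0 -> \bar R)
    (c_measurable : measurable_fun [set: borel_sub x0 * borel_sub a0] c)
    (c_bounded_below : exists K : R, forall xa, K%:E <= c xa)
    (c_inf_compact :
      forall x : borel_sub x0, inf_compact (fun a : borel_sub a0 => c (x, a)))
    (q_setwise_continuous :
      forall (x : borel_sub x0) (B : set (borel_sub x0)), measurable B ->
        continuous (fun a : borel_sub a0 => q (x, a) B))
    (alpha : nat -> R)
    (alpha_range : forall n, (0 <= alpha n < 1)%R)
    (alpha_nondecreasing : forall i j, (i <= j)%N -> (alpha i <= alpha j)%R)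
    (alpha_cvg : alpha @ \oo --> (1%R : R))
    (w_star_finite : w_star q c < +oo)
    (u_finite : forall x : borel_sub x0, u_lim q c alpha x < +oo) :
  (* Measurability of u is what gives a meaning to its integral below. *)
  measurable_fun [set: borel_sub x0] (u_lim q c alpha) /\
  exists phi : {mfun borel_sub x0 >-> borel_sub a0},
    (forall x : borel_sub x0,
      c (x, phi x) + \int[q (x, phi x)]_y u_lim q c alpha y
        <= w_bar q c + u_lim q c alpha x) /\
    average_cost_optimal q c (deterministic_policy R phi).
Proof.
have [K cK] := c_bounded_below.
split.
  exact: (measurable_u_lim polishX polishA borelX borelA c_measurable cK).
have [phi hphi] := optimality_inequality polishX polishA borelX borelA
  c_measurable cK c_inf_compact q_setwise_continuous w_star_finite alpha_range
  alpha_nondecreasing alpha_cvg u_finite.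
exists phi; split => [x|]; last first.
  exact: (optimality_inequality_average polishX polishA borelX borelA
    c_measurable cK).
rewrite -(excess_costK c K) addeAC.
apply: le_trans (leeD2r K%:E (hphi x)) _.
by rewrite -addeA -EFinD subrK addeC fineK// (w_bar_fin_num c_measurable cK).
Qed.
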